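(* Let $F_{\bar P}:\mathbb S\times\mathbb S\setminus\Delta\to\mathbb S\times\mathbb S\setminus\Delta$ be the two-dimensional Bowen–Series map $F_{\bar P}(x,y)=(T_ix,T_iy)$ if $y\in[P_i,P_{i+1})$. Then: (1) $F_{\bar P}$ possesses a bijectivity domain $\Omega$ (i.e. $F_{\bar P}$ maps $\Omega$ bijectively onto itself) having a finite rectangular structure; and (2) every point $(x,y)\in\mathbb S\times\mathbb S\setminus\Delta$ is mapped into $\Omega$ after finitely many iterations of $F_{\bar P}$.
   Context: Setting. Fix $g\ge 2$. Work in the Poincaré unit disk $\mathbb D$ with hyperbolic metric; let $\mathbb S$ be the unit circle and $\Delta=\{(x,x):x\in\mathbb S\}$. Let $\mathcal F$ be the regular hyperbolic $(8g-4)$-gon centered at $0$ with all interior angles $\pi/2$ (fundamental domain of a cocompact torsion-free Fuchsian group of genus $g$). Indices are mod $8g-4$. Label the sides $1,\dots,8g-4$ counterclockwise, vertices $V_i$ with side $i$ joining $V_i$ to $V_{i+1}$. The complete geodesic extending side $i$ goes from $P_i\in\mathbb S$ (beyond $V_i$) to $Q_{i+1}\in\mathbb S$ (beyond $V_{i+1}$); counterclockwise order on $\mathbb S$: $P_1,Q_1,P_2,Q_2,\dots,P_{8g-4},Q_{8g-4}$. Let $\sigma(i)=4g-i$ ($i$ odd), $\sigma(i)=2-i$ ($i$ even). $T_i$ is the Möbius transformation of $\mathbb D$ mapping side $i$ onto side $\sigma(i)$, with isometric circle the geodesic $P_iQ_{i+1}$, mapping it onto the geodesic $Q_{\sigma(i)+1}P_{\sigma(i)}$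 (inside to outside), with $T_{\sigma(i)}T_i=\mathrm{Id}$. Arcs $[A,B)$ etc. are counterclockwise from $A$ to $B$. A set has finite rectangular structure if (in angular coordinates) it is bounded by non-decreasing step functions with a finite number of steps. *)

(* Defs.v *)
From Stdlib Require Import Reals ZArith List ClassicalEpsilon.
From Coquelicot Require Import Coquelicot.
Open Scope R_scope.

(* Number of sides N = 8g-4 (as a real and as an integer). *)
Definition NZ (g : nat) : Z := (8 * Z.of_nat g - 4)%Z.
Definition NR (g : nat) : R := IZR (NZ g).

Definition expi (t : R) : C := (cos t, sin t).

(* Half-angle alpha of the arc cut out by each side geodesic:
   sin alpha = sqrt 2 * sin (PI / N)  (interior angles pi/2). *)
Definition alpha (g : nat) : R := asin (sqrt 2 * sin (PI / NR g)).

(* Angular direction of the midpoint of side i (sides labelled ccw). *)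
Definition phi (g : nat) (i : Z) : R := 2 * PI * IZR i / NR g.

(* Angular coordinates of P_i and Q_i. Side i's geodesic runs from
   P_i = expi (phi i - alpha) to Q_{i+1} = expi (phi i + alpha). *)
Definition angP (g : nat) (i : Z) : R := phi g i - alpha g.
Definition angQ (g : nat) (i : Z) : R := phi g (i - 1) + alpha g.

Definition sigma (g : nat) (i : Z) : Z :=
  if Z.odd i then (4 * Z.of_nat g - i)%Z else (2 - i)%Z.

(* The generator T_i: rotate side i to direction 0, half-turn about the
   point of the geodesic closest to 0 (z |-> (c - z)/(1 - c z), c = cos alpha),
   rotate direction 0 to side sigma(i). *)
Definition T (g : nat) (i : Z) (z : C) : C :=
  let c := RtoC (cos (alpha g)) in
  let w := Cmult (expi (- phi g i)) z in
  Cmult (expi (phi g (sigma g i))) (Cdiv (Cminus c w) (Cminus (RtoC 1) (Cmult c w))).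

Definition onS (z : C) : Prop := Cmod z = 1.
Definition inD (p : C * C) : Prop := onS (fst p) /\ onS (snd p) /\ fst p <> snd p.

Definition in_arc (a b : R) (z : C) : Prop := exists t, a <= t < b /\ z = expi t.

Definition idx (g : nat) (y : C) : Z :=
  epsilon (inhabits 1%Z)
    (fun i => (1 <= i <= NZ g)%Z /\ in_arc (angP g i) (angP g (i + 1)) y).

Definition F (g : nat) (p : C * C) : C * C :=
  let i := idx g (snd p) in (T g i (fst p), T g i (snd p)).

(* Finite rectangular structure: in angular coordinates (x, y) with
   y in [a, a + 2pi) and x lifted to (y, y + 2pi), the set is bounded by
   (lies between the open and the closed region determined by) two
   non-decreasing step functions f <= x <= h with finitely many steps. *)
Definition finite_rect (Om : C * C -> Prop) : Prop :=
  exists (a : R) (f h : R -> R) (sf sh : list R),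
    (forall y, a <= y < a + 2 * PI -> In (f y) sf /\ In (h y) sh) /\
    (forall y1 y2, a <= y1 <= y2 -> y2 < a + 2 * PI ->
        f y1 <= f y2 /\ h y1 <= h y2) /\
    (forall x y, a <= y < a + 2 * PI -> y < x < y + 2 * PI ->
        (f y < x < h y -> Om (expi x, expi y)) /\
        (Om (expi x, expi y) -> f y <= x <= h y)).

Definition bij_domain (g : nat) (Om : C * C -> Prop) : Prop :=
  (forall p, Om p -> inD p) /\
  (forall p, Om p -> Om (F g p)) /\
  (forall p q, Om p -> Om q -> F g p = F g q -> p = q) /\
  (forall q, Om q -> exists p, Om p /\ F g p = q).

(* Main.v *)
Require Import Defs.
From Stdlib Require Import Reals ZArith List Lra Lia.
From Coquelicot Require Import Coquelicot.

(* Seen from side i and side sigma(i), every T_i is the same half-turn, whose lift h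
   to the line permutes the points P, Q in a known way. For
     Omega = { x in [Q_{i+2}, P_{i-1}) if y in [P_i, Q_i),
               x in [Q_{i+2}, P_i)     if y in [Q_i, P_{i+1}) }
   the images of the strips of Omega tile Omega, which gives bijectivity.
   A point outside Omega has x close to y. As long as x and y lie in the same arc
   [P_i, P_{i+1}) their distance grows. If x is beyond P_{i+1}, then y is driven away
   from P_{i+1} (T_i expands there) until the orbit enters Omega. If x is before P_i,
   then y is driven away from Q_i; x and y then straddle some Q_j, are driven apart,
   and cross a point P at most once more before the orbit enters Omega. *)

(** * Dynamics relative to a side *)

(** The obstacle is that [h] expands [[P_i, P_(i+1))] only weakly at one end: its slope is 1 at [-a]
    and [a], the ends of the isometric circle, and [-a = P_i] belongs to the arc. The point [beta]
    bounds a neighbourhood of [P_i] that is left after one step; from [beta] on the slope is at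
    least [lambda > 1]. After passage to the next side, a step of [F] reads
    [(u, v) -> (h u - m, h v - m)] with one integer [m]. The pairing [sigma] comes in only on the
    circle, as a bijection of the sides, so the dynamics concerns [h] alone. Besides the images of
    boundary points, the bound on the number of crossings of a point P uses the estimate [htl_half].
    Convexity gives [h (-1/2) <= a + 1/2], and this is at most [2 - a] exactly when [a <= 3/4],
    whence that constant. *)

(* In units of [2 PI / N] and relative to the midpoint of side [i], the boundary
   points are [P_(i-1) = -1-a], [P_i = -a], [Q_i = a-1], [P_(i+1) = 1-a],
   [Q_(i+1) = a], [Q_(i+2) = 1+a]; [h] is the lift to the line of [T_i] read from
   side [i] to side [sigma i], and [h beta] is [P_(sigma i + 2)]. *)
Record half_turn_lift (N : Z) (a : R) (h : R -> R) (beta lambda : R) : Prop := {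
  htl_N : 12 <= IZR N;
  htl_a : 1 / 2 < a <= 3 / 4;
  htl_incr : forall x y, x < y -> h x < h y;
  htl_shift : forall x, h (x + IZR N) = h x + IZR N;
  htl_invol : forall x, h (h x) = x + IZR N;
  htl_prevP : h (- 1 - a) = 1 - a;
  htl_P : h (- a) = a;
  htl_Q : h (a - 1) = 1 + a;
  htl_beta : h beta = 2 - a;
  htl_half : h (- (1 / 2)) <= 2 - a;
  htl_odd : forall x, h (- x) = IZR N - h x;
  htl_expand : forall p q, - a <= p <= q -> q <= a -> q - p <= h q - h p;
  htl_lambda : 1 < lambda;
  htl_expand_lambda : forall p q, beta <= p <= q -> q <= 1 - a ->
    lambda * (q - p) <= h q - h p }.

Lemma htl_incr_le N a h beta lambda (H : half_turn_lift N a h beta lambda) x y :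
  x <= y -> h x <= h y.
Proof.
  intros [Hl | ->]; [left; now apply (htl_incr _ _ _ _ _ H) | right; reflexivity].
Qed.

Lemma htl_lt_inv N a h beta lambda (H : half_turn_lift N a h beta lambda) x y :
  h x < h y -> x < y.
Proof.
  intros Hl. destruct (Rlt_le_dec x y) as [|Hle]; [easy|].
  apply (htl_incr_le _ _ _ _ _ H) in Hle. lra.
Qed.

Lemma htl_le_inv N a h beta lambda (H : half_turn_lift N a h beta lambda) x y :
  h x <= h y -> x <= y.
Proof.
  intros Hl. destruct (Rle_lt_dec x y) as [|Hlt]; [easy|].
  apply (htl_incr _ _ _ _ _ H) in Hlt. lra.
Qed.

Lemma htl_nextP N a h beta lambda (H : half_turn_lift N a h beta lambda) :
  h (1 - a) = IZR N - 1 - a.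
Proof. rewrite <- (htl_prevP _ _ _ _ _ H), (htl_invol _ _ _ _ _ H). ring. Qed.

Lemma htl_nextQ N a h beta lambda (H : half_turn_lift N a h beta lambda) :
  h a = IZR N - a.
Proof.
  rewrite <- (htl_P _ _ _ _ _ H) at 1. rewrite (htl_invol _ _ _ _ _ H). ring.
Qed.

Lemma htl_nextnextQ N a h beta lambda (H : half_turn_lift N a h beta lambda) :
  h (1 + a) = IZR N - 1 + a.
Proof. rewrite <- (htl_Q _ _ _ _ _ H), (htl_invol _ _ _ _ _ H). ring. Qed.

Lemma htl_beta_lt N a h beta lambda (H : half_turn_lift N a h beta lambda) :
  beta < a - 1.
Proof.
  apply (htl_lt_inv _ _ _ _ _ H). rewrite (htl_beta _ _ _ _ _ H), (htl_Q _ _ _ _ _ H).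
  pose proof (htl_a _ _ _ _ _ H). lra.
Qed.

(** This lemma and the three after it round bounds on integers without leaving the reals, so that
    [lra] can combine them with bounds on [a] and [h]. *)
Lemma IZR_lt_le (m n : Z) : IZR m < IZR n + 1 -> IZR m <= IZR n.
Proof. intros Hl. apply IZR_le, Zlt_succ_le, lt_IZR. rewrite succ_IZR. exact Hl. Qed.

Lemma IZR_lt_le_minus (m n k : Z) :
  IZR m < IZR n - IZR k + 1 -> IZR m <= IZR n - IZR k.
Proof. rewrite <- minus_IZR. apply IZR_lt_le. Qed.

Lemma IZR_gt_ge (m n : Z) : IZR n - 1 < IZR m -> IZR n <= IZR m.
Proof. intros Hl. apply IZR_lt_le. lra. Qed.

Lemma IZR_gt_ge_minus (m n k : Z) :
  IZR n - IZR k - 1 < IZR m -> IZR n - IZR k <= IZR m.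
Proof. rewrite <- minus_IZR. apply IZR_gt_ge. Qed.

Lemma unit_window (b x : R) : exists m : Z, b <= x - IZR m < b + 1.
Proof.
  exists (up (x - b) - 1)%Z. rewrite minus_IZR.
  destruct (archimed (x - b)). lra.
Qed.

(** A quantity bounded by [M] cannot be multiplied by [lambda > 1] forever. The induction is on an
    [n] with [M < lambda ^ n * pot s], which bounds the number of steps left. Carrying [Goal]
    backwards along a step avoids counting iterations of the map. *)
Lemma growth (S : Type) (Inv Goal : S -> Prop) (pot : S -> R) (lambda M : R) :
  1 < lambda ->
  (forall s, Inv s -> 0 < pot s <= M) ->
  (forall s, Inv s -> Goal s \/
     exists s', Inv s' /\ lambda * pot s <= pot s' /\ (Goal s' -> Goal s)) ->
  forall s, Inv s -> Goal s.
Proof.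
  intros Hl Hpot Hstep.
  assert (Hn : forall n s, Inv s -> M < lambda ^ n * pot s -> Goal s).
  { induction n as [|n IH]; intros s Hs HM.
    - simpl in HM. destruct (Hpot s Hs). lra.
    - destruct (Hstep s Hs) as [|[s' [Hs' [Hp HG]]]]; [easy|].
      apply HG, IH; [easy|]. simpl in HM.
      assert (0 < lambda ^ n) by (apply pow_lt; lra). nra. }
  intros s Hs. destruct (Hpot s Hs) as [Hp _].
  destruct (Pow_x_infinity lambda) with (b := (Rabs M + 1) / pot s) as [n Hlim].
  { rewrite Rabs_right; lra. }
  apply (Hn n s Hs). specialize (Hlim n (le_n n)).
  rewrite Rabs_right in Hlim by (apply Rle_ge, pow_le; lra).
  apply Rge_le, (Rmult_le_compat_r (pot s)) in Hlim; [|lra].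
  unfold Rdiv in Hlim. rewrite Rmult_assoc, Rinv_l, Rmult_1_r in Hlim by lra.
  pose proof (Rle_abs M). lra.
Qed.

(* The attractor relative to side [i], for [y = u] and [x = v]:
   [x] in [[Q_(i+2), P_(i-1))] if [y] in [[P_i, Q_i)], and
   [x] in [[Q_(i+2), P_i)] if [y] in [[Q_i, P_(i+1))]. *)
Definition rel_Om (N : Z) (a u v : R) : Prop :=
  (- a <= u < a - 1 /\ 1 + a <= v < IZR N - 1 - a) \/
  (a - 1 <= u < 1 - a /\ 1 + a <= v < IZR N - a).

(** * Every orbit enters the attractor, in relative coordinates *)

(** The next side is [sigma i + m]. Both coordinates are shifted by the same [m] because [y] alone
    selects the side; no side is recorded, since [h] is the same for all. *)
Inductive reaches (N : Z) (a : R) (h : R -> R) : R -> R -> Prop :=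
| reaches_Om u v : rel_Om N a u v -> reaches N a h u v
| reaches_step u v (m : Z) : - a <= h u - IZR m < 1 - a ->
    reaches N a h (h u - IZR m) (h v - IZR m) -> reaches N a h u v.

(* The form of [reaches_step] used when [v] is close to [u + N]. *)
Lemma reaches_step_below N a h beta lambda (H : half_turn_lift N a h beta lambda)
  u w (m : Z) : - a <= h u - IZR m < 1 - a ->
  reaches N a h (h u - IZR m) (h w - IZR m + IZR N) -> reaches N a h u (w + IZR N).
Proof.
  intros Hm Hr. apply (reaches_step _ _ _ _ _ m Hm).
  rewrite (htl_shift _ _ _ _ _ H).
  replace (h w + IZR N - IZR m) with (h w - IZR m + IZR N) by ring. exact Hr.
Qed.

(** The image of [[P_i, P_(i+1))] is the arc from [a] to [N - 1 - a], which misses the surroundings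
    of side [sigma i]; hence the range of [m]. *)
Lemma next_index N a h beta lambda (H : half_turn_lift N a h beta lambda) u :
  - a <= u < 1 - a -> exists m : Z,
    - a <= h u - IZR m < 1 - a /\ 1 <= IZR m <= IZR N - 2.
Proof.
  intros [Hu1 Hu2]. destruct (unit_window (- a) (h u)) as [m Hm]. exists m.
  split; [lra|].
  apply (htl_incr_le _ _ _ _ _ H) in Hu1. apply (htl_incr _ _ _ _ _ H) in Hu2.
  rewrite (htl_P _ _ _ _ _ H) in Hu1. rewrite (htl_nextP _ _ _ _ _ H) in Hu2.
  pose proof (htl_a _ _ _ _ _ H).
  split; [apply IZR_gt_ge | apply IZR_lt_le_minus]; lra.
Qed.

(** The potential is the distance from [y] to [P_(i+1)]. If the new [x] is still before [Q_(j+2)] on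
    the new side [j], then [m = N - 2]. This shift takes [P_(i+1)] to [P_(j+1)], so the distance is
    stretched, by [lambda] because [u >= beta]. *)
Lemma reaches_far_above N a h beta lambda (H : half_turn_lift N a h beta lambda) u v :
  - a <= u < 1 - a -> 2 - a <= v < 1 + a -> reaches N a h u v.
Proof.
  intros Hu Hv.
  pose (Inv := fun s : R * R => - a <= fst s < 1 - a /\ 2 - a <= snd s < 1 + a).
  apply (growth (R * R) Inv (fun s => reaches N a h (fst s) (snd s))
           (fun s => 1 - a - fst s) lambda 1 (htl_lambda _ _ _ _ _ H))
    with (s := (u, v)); [| |split; assumption]; clear u v Hu Hv;
    intros [u v] [Hu Hv]; simpl in *; [lra|].
  destruct (next_index _ _ _ _ _ H u Hu) as [m [Hm HmN]].
  pose proof (htl_a _ _ _ _ _ H). pose proof (htl_N _ _ _ _ _ H).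
  assert (Hv1 : h a <= h v) by (apply (htl_incr_le _ _ _ _ _ H); lra).
  assert (Hv2 : h v < h (1 + a)) by (apply (htl_incr _ _ _ _ _ H); lra).
  rewrite (htl_nextQ _ _ _ _ _ H) in Hv1. rewrite (htl_nextnextQ _ _ _ _ _ H) in Hv2.
  destruct (Rlt_le_dec (h v - IZR m) (1 + a)) as [Hlt|Hge].
  - assert (IZR N - 2 <= IZR m) by (apply IZR_gt_ge_minus; lra).
    right. exists (h u - IZR m, h v - IZR m). unfold Inv; simpl.
    split; [lra|]. split; [|intros Hr; exact (reaches_step _ _ _ _ _ m Hm Hr)].
    assert (beta <= u).
    { apply (htl_le_inv _ _ _ _ _ H). rewrite (htl_beta _ _ _ _ _ H). lra. }
    pose proof (htl_expand_lambda _ _ _ _ _ H u (1 - a) ltac:(lra) ltac:(lra)) as He.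
    rewrite (htl_nextP _ _ _ _ _ H) in He. lra.
  - left. apply (reaches_step _ _ _ _ _ m Hm), reaches_Om. unfold rel_Om.
    destruct (Rlt_le_dec (h u - IZR m) (a - 1)); [left|right]; [|lra].
    assert (Hu1 : h (-a) <= h u) by (apply (htl_incr_le _ _ _ _ _ H); lra).
    rewrite (htl_P _ _ _ _ _ H) in Hu1.
    assert (2 <= IZR m) by (apply IZR_gt_ge; lra). lra.
Qed.

(** The potential of [reaches_far_above] works again, except that [m = N - 3] is now possible. That
    shift puts [x] at or beyond [P_(j+2)], which is the previous case. *)
Lemma reaches_above N a h beta lambda (H : half_turn_lift N a h beta lambda) u v :
  - a <= u < 1 - a -> 1 - a <= v < 1 + a -> reaches N a h u v.
Proof.
  intros Hu Hv.
  pose (Inv := fun s : R * R => - a <= fst s < 1 - a /\ 1 - a <= snd s < 1 + a).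
  apply (growth (R * R) Inv (fun s => reaches N a h (fst s) (snd s))
           (fun s => 1 - a - fst s) lambda 1 (htl_lambda _ _ _ _ _ H))
    with (s := (u, v)); [| |split; assumption]; clear u v Hu Hv;
    intros [u v] [Hu Hv]; simpl in *; [lra|].
  destruct (next_index _ _ _ _ _ H u Hu) as [m [Hm HmN]].
  pose proof (htl_a _ _ _ _ _ H). pose proof (htl_N _ _ _ _ _ H).
  assert (Hv1 : h (1 - a) <= h v) by (apply (htl_incr_le _ _ _ _ _ H); lra).
  assert (Hv2 : h v < h (1 + a)) by (apply (htl_incr _ _ _ _ _ H); lra).
  rewrite (htl_nextP _ _ _ _ _ H) in Hv1. rewrite (htl_nextnextQ _ _ _ _ _ H) in Hv2.
  destruct (Rlt_le_dec (h v - IZR m) (1 + a)) as [Hlt|Hge].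
  - destruct (Rlt_le_dec (IZR m) (IZR N - 2)) as [Hm2|Hm2].
    + left. apply (reaches_step _ _ _ _ _ m Hm).
      apply (reaches_far_above _ _ _ _ _ H); [easy|].
      assert (IZR m <= IZR N - 3) by (apply IZR_lt_le_minus; lra). lra.
    + right. exists (h u - IZR m, h v - IZR m). unfold Inv; simpl.
      split; [lra|]. split; [|intros Hr; exact (reaches_step _ _ _ _ _ m Hm Hr)].
      assert (beta <= u).
      { apply (htl_le_inv _ _ _ _ _ H). rewrite (htl_beta _ _ _ _ _ H). lra. }
      pose proof (htl_expand_lambda _ _ _ _ _ H u (1 - a) ltac:(lra) ltac:(lra)) as He.
      rewrite (htl_nextP _ _ _ _ _ H) in He. lra.
  - left. apply (reaches_step _ _ _ _ _ m Hm), reaches_Om. unfold rel_Om.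
    destruct (Rlt_le_dec (h u - IZR m) (a - 1)); [left|right]; [|lra].
    assert (Hu1 : h (-a) <= h u) by (apply (htl_incr_le _ _ _ _ _ H); lra).
    rewrite (htl_P _ _ _ _ _ H) in Hu1.
    assert (2 <= IZR m) by (apply IZR_gt_ge; lra). lra.
Qed.

(* [h] does not expand near [- a], but a pair whose lower point [p] is there
   ([p < beta]) is moved away from [- a] in one step; the factor [sqrt lambda]
   makes every step expanding. *)
Definition gap_weight (beta lambda p q : R) : R :=
  (q - p) * (if Rlt_dec p beta then 1 else sqrt lambda).

Lemma gap_weight_bounds beta lambda p q : 1 < lambda -> p < q -> q - p <= 1 ->
  0 < gap_weight beta lambda p q <= sqrt lambda.
Proof.
  intros Hl Hpq H1. unfold gap_weight.
  assert (1 < sqrt lambda) by (rewrite <- sqrt_1; apply sqrt_lt_1; lra).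
  destruct (Rlt_dec p beta); nra.
Qed.

Lemma gap_weight_grows N a h beta lambda (H : half_turn_lift N a h beta lambda)
  p q (m : Z) : - a <= p < q -> q < 1 - a -> - a <= h p - IZR m ->
  h q - IZR m < 1 - a ->
  sqrt lambda * gap_weight beta lambda p q <=
  gap_weight beta lambda (h p - IZR m) (h q - IZR m).
Proof.
  intros Hp Hq Hhp Hhq.
  pose proof (htl_a _ _ _ _ _ H). pose proof (htl_lambda _ _ _ _ _ H).
  pose proof (htl_beta_lt _ _ _ _ _ H).
  assert (H1s : 1 < sqrt lambda) by (rewrite <- sqrt_1; apply sqrt_lt_1; lra).
  assert (Hss : sqrt lambda * sqrt lambda = lambda) by (apply sqrt_sqrt; lra).
  unfold gap_weight. destruct (Rlt_dec p beta) as [Hb|Hb].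
  (* Near [-a] the length merely does not shrink, but [m <= 1] puts the new lower point at or above
     [a - 1 > beta], and the weight gains the factor [sqrt lambda]. *)
  - assert (Hp1 : h p < h beta) by (now apply (htl_incr _ _ _ _ _ H)).
    rewrite (htl_beta _ _ _ _ _ H) in Hp1.
    assert (Hp2 : h (- a) <= h p) by (apply (htl_incr_le _ _ _ _ _ H); lra).
    rewrite (htl_P _ _ _ _ _ H) in Hp2.
    assert (IZR m <= 1) by (apply IZR_lt_le; lra).
    pose proof (htl_expand _ _ _ _ _ H p q ltac:(lra) ltac:(lra)).
    destruct (Rlt_dec (h p - IZR m) beta); [lra|].
    rewrite Rmult_1_r, Rmult_comm. apply Rmult_le_compat_r; lra.
  (* Here the length grows by [lambda], which pays for the possible loss of one factor
     [sqrt lambda]. *)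
  - pose proof (htl_expand_lambda _ _ _ _ _ H p q ltac:(lra) ltac:(lra)).
    replace (sqrt lambda * ((q - p) * sqrt lambda)) with
      (sqrt lambda * sqrt lambda * (q - p)) by ring.
    rewrite Hss.
    assert (0 <= h q - h p) by nra.
    destruct (Rlt_dec (h p - IZR m) beta); nra.
Qed.

Lemma reaches_just_above N a h beta lambda (H : half_turn_lift N a h beta lambda) u v :
  - a <= u < v -> v < 1 - a -> reaches N a h u v.
Proof.
  intros Hu Hv. pose proof (htl_lambda _ _ _ _ _ H) as Hl.
  pose (Inv := fun s : R * R => - a <= fst s < snd s /\ snd s < 1 - a).
  apply (growth (R * R) Inv (fun s => reaches N a h (fst s) (snd s))
           (fun s => gap_weight beta lambda (fst s) (snd s))
           (sqrt lambda) (sqrt lambda))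
    with (s := (u, v)); [rewrite <- sqrt_1; apply sqrt_lt_1; lra| | |split; assumption];
    clear u v Hu Hv; intros [u v] [Hu Hv]; simpl in *;
    [apply gap_weight_bounds; lra|].
  destruct (next_index _ _ _ _ _ H u ltac:(lra)) as [m [Hm HmN]].
  pose proof (htl_a _ _ _ _ _ H). pose proof (htl_N _ _ _ _ _ H).
  assert (Hv1 : h u < h v) by (apply (htl_incr _ _ _ _ _ H); lra).
  assert (Hv2 : h v < h (1 - a)) by (apply (htl_incr _ _ _ _ _ H); lra).
  rewrite (htl_nextP _ _ _ _ _ H) in Hv2.
  destruct (Rlt_le_dec (h v - IZR m) (1 - a)) as [Hlt|Hge].
  - right. exists (h u - IZR m, h v - IZR m). unfold Inv; simpl.
    split; [lra|]. split; [|intros Hr; exact (reaches_step _ _ _ _ _ m Hm Hr)].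
    apply (gap_weight_grows _ _ _ _ _ H); lra.
  - left. apply (reaches_step _ _ _ _ _ m Hm).
    destruct (Rlt_le_dec (h v - IZR m) (1 + a)) as [Hlt2|Hge2].
    + now apply (reaches_above _ _ _ _ _ H).
    + apply reaches_Om. unfold rel_Om.
      destruct (Rlt_le_dec (h u - IZR m) (a - 1)); [left|right]; lra.
Qed.

(* Relative to the side [j] reached after two steps, the point starting at [Q_(i-1)]
   lies before [P_(j+2)]: a second passage of [x] across a point [P] leads into the
   attractor. *)
Lemma htl_two_steps N a h beta lambda (H : half_turn_lift N a h beta lambda) :
  h (h (a - 2) - 1) <= 2 - a.
Proof.
  pose proof (htl_half _ _ _ _ _ H) as Hh.
  (* By oddness [htl_half] says [h (1 / 2) >= N - 2 + a]; applying [h] to this inequality and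
     cancelling the full turn gives the claim. *)
  assert (h (a - 2) <= 1 / 2).
  { assert (Hle : h (a - 2 + IZR N) <= h (h (1 / 2))).
    { apply (htl_incr_le _ _ _ _ _ H).
      pose proof (htl_odd _ _ _ _ _ H (1 / 2)). lra. }
    rewrite (htl_invol _ _ _ _ _ H), (htl_shift _ _ _ _ _ H) in Hle. lra. }
  apply Rle_trans with (2 := Hh), (htl_incr_le _ _ _ _ _ H). lra.
Qed.

(** The bound [h (a - 2) - 1] is the image of [Q_(i-1)] under a step with [m = 1], the step by which
    [reaches_far_below] leaves its region. By [htl_two_steps], [h w < 2 - a]. Since [m >= 2], the
    new [x] is before [P_j]; if the new [y] is before [Q_j], then [m >= 3] and [x] is before
    [P_(j-1)]. *)
Lemma reaches_below_one_step N a h beta lambda (H : half_turn_lift N a h beta lambda) u w :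
  a - 1 <= u < 1 - a -> - a <= w < h (a - 2) - 1 -> reaches N a h u (w + IZR N).
Proof.
  intros Hu Hw.
  pose proof (htl_a _ _ _ _ _ H). pose proof (htl_N _ _ _ _ _ H).
  destruct (next_index _ _ _ _ _ H u ltac:(lra)) as [m [Hm HmN]].
  assert (Hw1 : h (- a) <= h w) by (apply (htl_incr_le _ _ _ _ _ H); lra).
  assert (Hw2 : h w < h (h (a - 2) - 1)) by (apply (htl_incr _ _ _ _ _ H); lra).
  assert (Hu1 : h (a - 1) <= h u) by (apply (htl_incr_le _ _ _ _ _ H); lra).
  pose proof (htl_two_steps _ _ _ _ _ H).
  rewrite (htl_P _ _ _ _ _ H) in Hw1. rewrite (htl_Q _ _ _ _ _ H) in Hu1.
  assert (2 <= IZR m) by (apply IZR_gt_ge; lra).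
  apply (reaches_step_below _ _ _ _ _ H _ _ m Hm), reaches_Om. unfold rel_Om.
  destruct (Rlt_le_dec (h u - IZR m) (a - 1)); [left|right; lra].
  assert (3 <= IZR m) by (apply IZR_gt_ge; lra). lra.
Qed.

(** Only [m = 1] and [m = 2] occur. The shift by 2 takes [Q_i] to [Q_j] and keeps the region, so the
    distance from [y] to [Q_i] grows; the shift by 1 moves [y] to or past [Q_j], where one more step
    suffices. *)
Lemma reaches_far_below N a h beta lambda (H : half_turn_lift N a h beta lambda) u w :
  - a <= u < a - 1 -> - 1 - a <= w < a - 2 -> reaches N a h u (w + IZR N).
Proof.
  intros Hu Hw.
  pose (Inv := fun s : R * R => - a <= fst s < a - 1 /\ - 1 - a <= snd s < a - 2).
  apply (growth (R * R) Inv (fun s => reaches N a h (fst s) (snd s + IZR N))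
           (fun s => a - 1 - fst s) lambda 1 (htl_lambda _ _ _ _ _ H))
    with (s := (u, w)); [| |split; assumption]; clear u w Hu Hw;
    intros [u w] [Hu Hw]; simpl in *; pose proof (htl_a _ _ _ _ _ H); [lra|].
  destruct (next_index _ _ _ _ _ H u ltac:(lra)) as [m [Hm HmN]].
  assert (Hw1 : h (- 1 - a) <= h w) by (apply (htl_incr_le _ _ _ _ _ H); lra).
  assert (Hw2 : h w < h (- a)) by (apply (htl_incr _ _ _ _ _ H); lra).
  assert (Hw3 : h w < h (a - 2)) by (apply (htl_incr _ _ _ _ _ H); lra).
  assert (Hu1 : h (- a) <= h u) by (apply (htl_incr_le _ _ _ _ _ H); lra).
  assert (Hu2 : h u < h (a - 1)) by (apply (htl_incr _ _ _ _ _ H); lra).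
  rewrite (htl_prevP _ _ _ _ _ H) in Hw1. rewrite (htl_P _ _ _ _ _ H) in Hw2, Hu1.
  rewrite (htl_Q _ _ _ _ _ H) in Hu2.
  destruct (Rlt_le_dec (IZR m) 2) as [Hm2|Hm2].
  - assert (IZR m <= 1) by (apply IZR_lt_le; lra).
    left. apply (reaches_step_below _ _ _ _ _ H _ _ m Hm).
    apply (reaches_below_one_step _ _ _ _ _ H); lra.
  - assert (IZR m <= 2) by (apply IZR_lt_le; lra).
    right. exists (h u - IZR m, h w - IZR m). unfold Inv; simpl.
    split; [lra|]. split; [|intros Hr; exact (reaches_step_below _ _ _ _ _ H _ _ m Hm Hr)].
    assert (beta <= u).
    { apply (htl_le_inv _ _ _ _ _ H). rewrite (htl_beta _ _ _ _ _ H). lra. }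
    pose proof (htl_expand_lambda _ _ _ _ _ H u (a - 1) ltac:(lra) ltac:(lra)) as He.
    rewrite (htl_Q _ _ _ _ _ H) in He. lra.
Qed.

(** If [x] stays in the arc of side [j], then [m = 2], which takes [Q_i] to [Q_j]: the pair
    straddles again with a larger weight. If [x] leaves and [y] is before [Q_j], then [m >= 3]
    forces [x] before [Q_(j-1)], which is why [reaches_far_below] may assume this. *)
Lemma reaches_straddling_Q N a h beta lambda (H : half_turn_lift N a h beta lambda) u w :
  a - 1 <= u < 1 - a -> - a <= w < a - 1 -> reaches N a h u (w + IZR N).
Proof.
  intros Hu Hw. pose proof (htl_lambda _ _ _ _ _ H) as Hl.
  pose (Inv := fun s : R * R => a - 1 <= fst s < 1 - a /\ - a <= snd s < a - 1).
  apply (growth (R * R) Inv (fun s => reaches N a h (fst s) (snd s + IZR N))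
           (fun s => gap_weight beta lambda (snd s) (fst s))
           (sqrt lambda) (sqrt lambda))
    with (s := (u, w)); [rewrite <- sqrt_1; apply sqrt_lt_1; lra| | |split; assumption];
    clear u w Hu Hw; intros [u w] [Hu Hw]; simpl in *;
    [apply gap_weight_bounds; lra|].
  pose proof (htl_a _ _ _ _ _ H). pose proof (htl_N _ _ _ _ _ H).
  destruct (next_index _ _ _ _ _ H u ltac:(lra)) as [m [Hm HmN]].
  assert (Hw1 : h (- a) <= h w) by (apply (htl_incr_le _ _ _ _ _ H); lra).
  assert (Hw2 : h w < h (a - 1)) by (apply (htl_incr _ _ _ _ _ H); lra).
  assert (Hu1 : h (a - 1) <= h u) by (apply (htl_incr_le _ _ _ _ _ H); lra).
  rewrite (htl_P _ _ _ _ _ H) in Hw1. rewrite (htl_Q _ _ _ _ _ H) in Hw2, Hu1.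
  assert (2 <= IZR m) by (apply IZR_gt_ge; lra).
  destruct (Rlt_le_dec (h w - IZR m) (- a)) as [Hlt|Hge].
  - left. apply (reaches_step_below _ _ _ _ _ H _ _ m Hm).
    destruct (Rlt_le_dec (h u - IZR m) (a - 1)) as [HA|HB].
    + assert (3 <= IZR m) by (apply IZR_gt_ge; lra).
      destruct (Rlt_le_dec (h w - IZR m) (- 1 - a)) as [Hlt2|Hge2].
      * apply reaches_Om. left. lra.
      * apply (reaches_far_below _ _ _ _ _ H); lra.
    + apply reaches_Om. right. lra.
  - assert (IZR m <= 2) by (apply IZR_lt_le; lra).
    right. exists (h u - IZR m, h w - IZR m). unfold Inv; simpl.
    split; [lra|]. split; [|intros Hr; exact (reaches_step_below _ _ _ _ _ H _ _ m Hm Hr)].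
    apply (gap_weight_grows _ _ _ _ _ H); lra.
Qed.

(** As in [reaches_far_below], [m = 2] repels [y] from [Q_i]. The shift by 1 takes [P_i] to [Q_j],
    so a pair straddling [P_i] becomes one straddling [Q_j]. *)
Lemma reaches_straddling_P N a h beta lambda (H : half_turn_lift N a h beta lambda) u w :
  - a <= u < a - 1 -> - 1 - a <= w < - a -> reaches N a h u (w + IZR N).
Proof.
  intros Hu Hw.
  pose (Inv := fun s : R * R => - a <= fst s < a - 1 /\ - 1 - a <= snd s < - a).
  apply (growth (R * R) Inv (fun s => reaches N a h (fst s) (snd s + IZR N))
           (fun s => a - 1 - fst s) lambda 1 (htl_lambda _ _ _ _ _ H))
    with (s := (u, w)); [| |split; assumption]; clear u w Hu Hw;
    intros [u w] [Hu Hw]; simpl in *; pose proof (htl_a _ _ _ _ _ H); [lra|].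
  destruct (next_index _ _ _ _ _ H u ltac:(lra)) as [m [Hm HmN]].
  assert (Hw1 : h (- 1 - a) <= h w) by (apply (htl_incr_le _ _ _ _ _ H); lra).
  assert (Hw2 : h w < h (- a)) by (apply (htl_incr _ _ _ _ _ H); lra).
  assert (Hu1 : h (- a) <= h u) by (apply (htl_incr_le _ _ _ _ _ H); lra).
  assert (Hu2 : h u < h (a - 1)) by (apply (htl_incr _ _ _ _ _ H); lra).
  rewrite (htl_prevP _ _ _ _ _ H) in Hw1. rewrite (htl_P _ _ _ _ _ H) in Hw2, Hu1.
  rewrite (htl_Q _ _ _ _ _ H) in Hu2.
  destruct (Rlt_le_dec (IZR m) 2) as [Hm2|Hm2].
  - assert (IZR m <= 1) by (apply IZR_lt_le; lra).
    left. apply (reaches_step_below _ _ _ _ _ H _ _ m Hm).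
    apply (reaches_straddling_Q _ _ _ _ _ H); lra.
  - assert (IZR m <= 2) by (apply IZR_lt_le; lra).
    right. exists (h u - IZR m, h w - IZR m). unfold Inv; simpl.
    split; [lra|]. split; [|intros Hr; exact (reaches_step_below _ _ _ _ _ H _ _ m Hm Hr)].
    assert (beta <= u).
    { apply (htl_le_inv _ _ _ _ _ H). rewrite (htl_beta _ _ _ _ _ H). lra. }
    pose proof (htl_expand_lambda _ _ _ _ _ H u (a - 1) ltac:(lra) ltac:(lra)) as He.
    rewrite (htl_Q _ _ _ _ _ H) in He. lra.
Qed.

Lemma reaches_just_below N a h beta lambda (H : half_turn_lift N a h beta lambda) u w :
  - a <= w < u -> u < 1 - a -> reaches N a h u (w + IZR N).
Proof.
  intros Hw Hu. pose proof (htl_lambda _ _ _ _ _ H) as Hl.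
  pose (Inv := fun s : R * R => - a <= snd s < fst s /\ fst s < 1 - a).
  apply (growth (R * R) Inv (fun s => reaches N a h (fst s) (snd s + IZR N))
           (fun s => gap_weight beta lambda (snd s) (fst s))
           (sqrt lambda) (sqrt lambda))
    with (s := (u, w)); [rewrite <- sqrt_1; apply sqrt_lt_1; lra| | |split; assumption];
    clear u w Hu Hw; intros [u w] [Hw Hu]; simpl in *;
    [apply gap_weight_bounds; lra|].
  pose proof (htl_a _ _ _ _ _ H). pose proof (htl_N _ _ _ _ _ H).
  destruct (next_index _ _ _ _ _ H u ltac:(lra)) as [m [Hm HmN]].
  assert (Hw1 : h (- a) <= h w) by (apply (htl_incr_le _ _ _ _ _ H); lra).
  assert (Hw2 : h w < h u) by (apply (htl_incr _ _ _ _ _ H); lra).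
  rewrite (htl_P _ _ _ _ _ H) in Hw1.
  destruct (Rlt_le_dec (h w - IZR m) (- a)) as [Hlt|Hge].
  - left. apply (reaches_step_below _ _ _ _ _ H _ _ m Hm).
    destruct (Rlt_le_dec (h u - IZR m) (a - 1)) as [HA|HB].
    + destruct (Rlt_le_dec (h w - IZR m) (- 1 - a)) as [Hlt2|Hge2].
      * apply reaches_Om. left. lra.
      * apply (reaches_straddling_P _ _ _ _ _ H); lra.
    + apply reaches_Om. right. lra.
  - right. exists (h u - IZR m, h w - IZR m). unfold Inv; simpl.
    split; [lra|]. split; [|intros Hr; exact (reaches_step_below _ _ _ _ _ H _ _ m Hm Hr)].
    apply (gap_weight_grows _ _ _ _ _ H); lra.
Qed.

Lemma reaches_all N a h beta lambda (H : half_turn_lift N a h beta lambda) u v :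
  - a <= u < 1 - a -> u < v < u + IZR N -> reaches N a h u v.
Proof.
  intros Hu Hv. pose proof (htl_a _ _ _ _ _ H).
  destruct (Rlt_le_dec v (1 - a)) as [H1|H1];
    [apply (reaches_just_above _ _ _ _ _ H); lra|].
  destruct (Rlt_le_dec v (1 + a)) as [H2|H2];
    [apply (reaches_above _ _ _ _ _ H); lra|].
  replace v with (v - IZR N + IZR N) by ring.
  destruct (Rlt_le_dec v (IZR N - a)) as [H3|H3];
    [|apply (reaches_just_below _ _ _ _ _ H); lra].
  destruct (Rlt_le_dec u (a - 1)) as [H4|H4];
    [|apply reaches_Om; right; lra].
  destruct (Rlt_le_dec v (IZR N - 1 - a)) as [H5|H5];
    [apply reaches_Om; left; lra|].
  apply (reaches_straddling_P _ _ _ _ _ H); lra.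
Qed.

(** * Bijectivity on the attractor, in relative coordinates *)

(** From the first strip [m] is 1 or 2, and its value decides the strip reached. From the second,
    landing in the first requires [m >= 3], and this extra shift provides the stricter upper bound
    on [x]. *)
Lemma rel_Om_step N a h beta lambda (H : half_turn_lift N a h beta lambda) u v (m : Z) :
  rel_Om N a u v -> - a <= h u - IZR m < 1 - a ->
  rel_Om N a (h u - IZR m) (h v - IZR m).
Proof.
  intros HO Hm. pose proof (htl_a _ _ _ _ _ H) as Ha. pose proof (htl_N _ _ _ _ _ H) as HN.
  pose proof (htl_P _ _ _ _ _ H) as HP. pose proof (htl_Q _ _ _ _ _ H) as HQ.
  pose proof (htl_nextP _ _ _ _ _ H) as HP1. pose proof (htl_nextnextQ _ _ _ _ _ H) as HQ2.
  pose proof (htl_shift _ _ _ _ _ H (-1 - a)) as HS1. rewrite (htl_prevP _ _ _ _ _ H) in HS1.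
  pose proof (htl_shift _ _ _ _ _ H (- a)) as HS2. rewrite HP in HS2.
  destruct HO as [[Hu Hv]|[Hu Hv]].
  - assert (h (- a) <= h u) by (apply (htl_incr_le _ _ _ _ _ H); lra).
    assert (h u < h (a - 1)) by (apply (htl_incr _ _ _ _ _ H); lra).
    assert (h (1 + a) <= h v) by (apply (htl_incr_le _ _ _ _ _ H); lra).
    assert (h v < h (-1 - a + IZR N)) by (apply (htl_incr _ _ _ _ _ H); lra).
    assert (1 <= IZR m) by (apply IZR_gt_ge; lra).
    assert (IZR m <= 2) by (apply IZR_lt_le; lra).
    destruct (Rlt_le_dec (IZR m) 2) as [Hm2|Hm2]; [right|left]; [|lra].
    assert (IZR m <= 1) by (apply IZR_lt_le; lra). lra.
  - assert (h (a - 1) <= h u) by (apply (htl_incr_le _ _ _ _ _ H); lra).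
    assert (h u < h (1 - a)) by (apply (htl_incr _ _ _ _ _ H); lra).
    assert (h (1 + a) <= h v) by (apply (htl_incr_le _ _ _ _ _ H); lra).
    assert (h v < h (- a + IZR N)) by (apply (htl_incr _ _ _ _ _ H); lra).
    assert (2 <= IZR m) by (apply IZR_gt_ge; lra).
    assert (IZR m <= IZR N - 2) by (apply IZR_lt_le_minus; lra).
    destruct (Rlt_le_dec (h u - IZR m) (a - 1)) as [HA|HB]; [left|right]; [|lra].
    assert (3 <= IZR m) by (apply IZR_gt_ge; lra). lra.
Qed.

Lemma rel_Om_step_inj N a h beta lambda (H : half_turn_lift N a h beta lambda)
  u1 v1 u2 v2 (m1 m2 : Z) : rel_Om N a u1 v1 -> rel_Om N a u2 v2 ->
  - a <= h u1 - IZR m1 < 1 - a ->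
  h u1 - IZR m1 = h u2 - IZR m2 -> h v1 - IZR m1 = h v2 - IZR m2 ->
  m1 = m2 /\ u1 = u2 /\ v1 = v2.
Proof.
  intros HO1 HO2 Hm Eu Ev.
  pose proof (htl_a _ _ _ _ _ H) as Ha. pose proof (htl_N _ _ _ _ _ H) as HN.
  pose proof (htl_P _ _ _ _ _ H) as HP. pose proof (htl_Q _ _ _ _ _ H) as HQ.
  pose proof (htl_nextnextQ _ _ _ _ _ H) as HQ2.
  pose proof (htl_shift _ _ _ _ _ H (-1 - a)) as HS1. rewrite (htl_prevP _ _ _ _ _ H) in HS1.
  pose proof (htl_shift _ _ _ _ _ H (- a)) as HS2. rewrite HP in HS2.
  assert (Hm12 : m1 = m2).
  (* Since [a > 1/2], both ranges of [h v] lie in the window [[N - 1 + a, N + a)] of length one, so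
     the new [x] alone determines [m]. *)
  { assert (Hrange : forall u v, rel_Om N a u v ->
      (a <= h u < 1 + a /\ IZR N - 1 + a <= h v < IZR N + 1 - a) \/
      (1 + a <= h u /\ IZR N - 1 + a <= h v < IZR N + a)).
    { intros u v HO. destruct HO as [[Hu Hv]|[Hu Hv]]; [left|right].
      - assert (h (- a) <= h u) by (apply (htl_incr_le _ _ _ _ _ H); lra).
        assert (h u < h (a - 1)) by (apply (htl_incr _ _ _ _ _ H); lra).
        assert (h (1 + a) <= h v) by (apply (htl_incr_le _ _ _ _ _ H); lra).
        assert (h v < h (-1 - a + IZR N)) by (apply (htl_incr _ _ _ _ _ H); lra).
        lra.
      - assert (h (a - 1) <= h u) by (apply (htl_incr_le _ _ _ _ _ H); lra).
        assert (h (1 + a) <= h v) by (apply (htl_incr_le _ _ _ _ _ H); lra).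
        assert (h v < h (- a + IZR N)) by (apply (htl_incr _ _ _ _ _ H); lra).
        lra. }
    apply Hrange in HO1. apply Hrange in HO2.
    assert (Hd : IZR m1 = IZR m2); [|now apply eq_IZR].
    destruct (Rtotal_order (IZR m1) (IZR m2)) as [Hlt|[|Hlt]]; [|easy|].
    - assert (IZR m1 <= IZR m2 - 1) by (apply IZR_lt_le_minus; lra).
      destruct HO1 as [HO1|HO1], HO2 as [HO2|HO2]; lra.
    - assert (IZR m2 <= IZR m1 - 1) by (apply IZR_lt_le_minus; lra).
      destruct HO1 as [HO1|HO1], HO2 as [HO2|HO2]; lra. }
  subst m2. split; [easy|].
  split; apply Rle_antisym; apply (htl_le_inv _ _ _ _ _ H); lra.
Qed.

Lemma rel_Om_step_surj N a h beta lambda (H : half_turn_lift N a h beta lambda) u v :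
  rel_Om N a u v -> exists u0 v0 (m : Z),
    rel_Om N a u0 v0 /\ h u0 - IZR m = u /\ h v0 - IZR m = v.
Proof.
  intros HO. pose proof (htl_a _ _ _ _ _ H) as Ha. pose proof (htl_N _ _ _ _ _ H) as HN.
  pose proof (htl_P _ _ _ _ _ H) as HP. pose proof (htl_Q _ _ _ _ _ H) as HQ.
  pose proof (htl_nextP _ _ _ _ _ H) as HP1. pose proof (htl_nextnextQ _ _ _ _ _ H) as HQ2.
  pose proof (htl_shift _ _ _ _ _ H (-1 - a)) as HS1. rewrite (htl_prevP _ _ _ _ _ H) in HS1.
  pose proof (htl_shift _ _ _ _ _ H (- a)) as HS2. rewrite HP in HS2.
  (* The involution gives the inverse of [h] as [y -> h y - N]. *)
  assert (Hinv : forall y, h (h y - IZR N) = y).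
  { intros y. pose proof (htl_shift _ _ _ _ _ H (h y - IZR N)) as E.
    replace (h y - IZR N + IZR N) with (h y) in E by ring.
    rewrite (htl_invol _ _ _ _ _ H) in E. lra. }
  assert (Hback : forall m : Z,
    (a <= u + IZR m < 1 + a /\ IZR N - 1 + a <= v + IZR m < IZR N + 1 - a) \/
    (1 + a <= u + IZR m < IZR N - 1 - a /\ IZR N - 1 + a <= v + IZR m < IZR N + a) ->
    exists u0 v0 (m : Z),
      rel_Om N a u0 v0 /\ h u0 - IZR m = u /\ h v0 - IZR m = v).
  { intros m Hm.
    exists (h (u + IZR m) - IZR N), (h (v + IZR m) - IZR N), m.
    rewrite 2!Hinv. split; [|lra].
    destruct Hm as [[Hu Hv]|[Hu Hv]]; [left|right];
      (split; split;
       [apply (htl_le_inv _ _ _ _ _ H)|apply (htl_lt_inv _ _ _ _ _ H)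
       |apply (htl_le_inv _ _ _ _ _ H)|apply (htl_lt_inv _ _ _ _ _ H)];
       rewrite Hinv).
    all: try lra.
    - replace (IZR N - 1 - a) with (-1 - a + IZR N) by ring. lra.
    - replace (IZR N - a) with (- a + IZR N) by ring. lra. }
  (* The window that contains every [h v] fixes [m]. The least possible value, 2 or 1 according to
     the strip of the target, pulls back to the first strip; all larger values pull back to the
     second. *)
  destruct (unit_window (IZR N - 1 + a) v) as [m' Hm'].
  assert (Hm : IZR N - 1 + a <= v + IZR (- m') < IZR N + a)
    by (rewrite opp_IZR; lra).
  revert Hm. generalize (- m')%Z. clear m' Hm'. intros m Hm.
  assert (1 <= IZR m) by (apply IZR_gt_ge; destruct HO; lra).
  assert (IZR m <= IZR N - 2) by (apply IZR_lt_le_minus; destruct HO; lra).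
  destruct HO as [[Hu Hv]|[Hu Hv]].
  - destruct (Rlt_le_dec (IZR m) 3) as [Hm3|Hm3].
    + apply (Hback 2%Z). left.
      assert (IZR m <= 2) by (apply IZR_lt_le; lra). lra.
    + apply (Hback m). right. lra.
  - destruct (Rlt_le_dec (IZR m) 2) as [Hm2|Hm2].
    + apply (Hback 1%Z). left.
      assert (IZR m <= 1) by (apply IZR_lt_le; lra). lra.
    + apply (Hback m). right. lra.
Qed.

(** * The lift of the half-turn *)

(** With [w = 1 - c e^(iu)], the half-turn sends [e^(iu)] to [- e^(iu) conj(w) / w]. As [Re w > 0],
    the arctangent is a continuous choice of argument on the whole line. *)
Definition lift (c u : R) : R := u + PI + 2 * atan (c * sin u / (1 - c * cos u)).

Lemma cos_2atan x : cos (2 * atan x) = (1 - x ^ 2) / (1 + x ^ 2).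
Proof.
  assert (Hc : 0 < cos (atan x)) by (destruct (atan_bound x); apply cos_gt_0; lra).
  assert (Hs : sin (atan x) = x * cos (atan x)).
  { rewrite <- (tan_atan x) at 2. unfold tan. field. lra. }
  pose proof (sin2_cos2 (atan x)) as H1. rewrite cos_2a. unfold Rsqr in H1.
  rewrite Hs in *. apply (Rmult_eq_reg_r (1 + x ^ 2)); [|nra].
  unfold Rdiv at 1. rewrite (Rmult_assoc (1 - x ^ 2)), Rinv_l, Rmult_1_r by nra.
  transitivity ((1 - x ^ 2) * (x * cos (atan x) * (x * cos (atan x)) + cos (atan x) * cos (atan x)));
    [ring|rewrite H1; ring].
Qed.

Lemma sin_2atan x : sin (2 * atan x) = 2 * x / (1 + x ^ 2).
Proof.
  assert (Hc : 0 < cos (atan x)) by (destruct (atan_bound x); apply cos_gt_0; lra).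
  assert (Hs : sin (atan x) = x * cos (atan x)).
  { rewrite <- (tan_atan x) at 2. unfold tan. field. lra. }
  pose proof (sin2_cos2 (atan x)) as H1. rewrite sin_2a. unfold Rsqr in H1.
  rewrite Hs in *. apply (Rmult_eq_reg_r (1 + x ^ 2)); [|nra].
  unfold Rdiv at 1. rewrite (Rmult_assoc (2 * x)), Rinv_l, Rmult_1_r by nra.
  transitivity ((2 * x) * (x * cos (atan x) * (x * cos (atan x)) + cos (atan x) * cos (atan x)));
    [ring|rewrite H1; ring].
Qed.

Lemma one_minus_cos_pos c u : 0 < c < 1 -> 0 < 1 - c * cos u.
Proof. intros Hc. pose proof (COS_bound u). nra. Qed.

Lemma lift_denom_pos c u : 0 < c < 1 -> 0 < 1 - 2 * c * cos u + c ^ 2.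
Proof. intros Hc. pose proof (COS_bound u). nra. Qed.

Lemma sin_sq u : sin u ^ 2 = 1 - cos u ^ 2.
Proof. pose proof (sin2_cos2 u). unfold Rsqr in *. nra. Qed.

Lemma lift_denom c u : 
  (1 - c * cos u) ^ 2 + (c * sin u) ^ 2 = 1 - 2 * c * cos u + c ^ 2.
Proof. rewrite Rpow_mult_distr, sin_sq. ring. Qed.

Lemma cos_lift c u : 0 < c < 1 ->
  cos (lift c u) = (2 * c - (1 + c ^ 2) * cos u) / (1 - 2 * c * cos u + c ^ 2).
Proof.
  intros Hc. pose proof (one_minus_cos_pos c u Hc). pose proof (lift_denom_pos c u Hc).
  pose proof (lift_denom c u) as Hd. pose proof (sin_sq u) as Hs.
  unfold lift. rewrite cos_plus, neg_cos, neg_sin, cos_2atan, sin_2atan.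
  rewrite <- Hd.
  replace (1 + (c * sin u / (1 - c * cos u)) ^ 2) with
    (((1 - c * cos u) ^ 2 + (c * sin u) ^ 2) / (1 - c * cos u) ^ 2) by (field; lra).
  transitivity ((- cos u * ((1 - c * cos u) ^ 2 - c ^ 2 * sin u ^ 2)
     + 2 * c * (1 - c * cos u) * sin u ^ 2)
     / ((1 - c * cos u) ^ 2 + (c * sin u) ^ 2)); [field; split; nra|].
  f_equal. rewrite Hs. ring.
Qed.

Lemma sin_lift c u : 0 < c < 1 ->
  sin (lift c u) = - (1 - c ^ 2) * sin u / (1 - 2 * c * cos u + c ^ 2).
Proof.
  intros Hc. pose proof (one_minus_cos_pos c u Hc). pose proof (lift_denom_pos c u Hc).
  pose proof (lift_denom c u) as Hd. pose proof (sin_sq u) as Hs.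
  unfold lift. rewrite sin_plus, neg_cos, neg_sin, cos_2atan, sin_2atan.
  rewrite <- Hd.
  replace (1 + (c * sin u / (1 - c * cos u)) ^ 2) with
    (((1 - c * cos u) ^ 2 + (c * sin u) ^ 2) / (1 - c * cos u) ^ 2) by (field; lra).
  transitivity ((- sin u * ((1 - c * cos u) ^ 2 - c ^ 2 * sin u ^ 2
     + 2 * c * (1 - c * cos u) * cos u))
     / ((1 - c * cos u) ^ 2 + (c * sin u) ^ 2)); [field; split; nra|].
  f_equal. rewrite Hs. ring.
Qed.

Lemma lift_invol c u : 0 < c < 1 -> lift c (lift c u) = u + 2 * PI.
Proof.
  intros Hc. pose proof (one_minus_cos_pos c u Hc). pose proof (lift_denom_pos c u Hc).
  unfold lift at 1. rewrite sin_lift, cos_lift by easy.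
  (* The argument of the arctangent at [lift c u] is the opposite of the one at [u], so the two
     corrections cancel and only the two summands [PI] remain. *)
  replace (c * _ / _) with (- (c * sin u / (1 - c * cos u))).
  - rewrite atan_opp. unfold lift. ring.
  - assert (0 < (1 - c ^ 2) * (1 - c * cos u)) by (apply Rmult_lt_0_compat; nra).
    replace (1 - c * ((2 * c - (1 + c ^ 2) * cos u) / (1 - 2 * c * cos u + c ^ 2)))
      with ((1 - c ^ 2) * (1 - c * cos u) / (1 - 2 * c * cos u + c ^ 2))
      by (field; lra).
    field. repeat split; nra.
Qed.

Lemma lift_odd c u : lift c (- u) = 2 * PI - lift c u.
Proof.
  unfold lift. rewrite sin_neg, cos_neg.
  replace (c * - sin u / (1 - c * cos u)) with (- (c * sin u / (1 - c * cos u)))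
    by (unfold Rdiv; ring).
  rewrite atan_opp. ring.
Qed.

Lemma lift_shift c u : lift c (u + 2 * PI) = lift c u + 2 * PI.
Proof. unfold lift. rewrite sin_plus, cos_plus, sin_2PI, cos_2PI.
  replace (sin u * 1 + cos u * 0) with (sin u) by ring.
  replace (cos u * 1 - sin u * 0) with (cos u) by ring. ring.
Qed.

(** The derivative is the Poisson kernel at the point [c]: it increases with [cos u] and equals 1
    where [cos u = c]. *)
Lemma is_derive_lift c u : 0 < c < 1 ->
  is_derive (lift c) u ((1 - c ^ 2) / (1 - 2 * c * cos u + c ^ 2)).
Proof.
  intros Hc. pose proof (one_minus_cos_pos c u Hc). pose proof (lift_denom_pos c u Hc).
  pose proof (lift_denom c u) as Hd. pose proof (sin_sq u) as Hs.
  unfold lift. auto_derive; [lra|].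
  transitivity (1 + 2 * (c * cos u * (1 - c * cos u) - c ^ 2 * sin u ^ 2)
    / ((1 - c * cos u) ^ 2 + (c * sin u) ^ 2)).
  - field. split; nra.
  - rewrite Hd, Hs. field. lra.
Qed.

Lemma lift_mvt c x y : 0 < c < 1 -> x < y -> exists z, x <= z <= y /\
  lift c y - lift c x = (1 - c ^ 2) / (1 - 2 * c * cos z + c ^ 2) * (y - x).
Proof.
  intros Hc Hxy.
  destruct (MVT_gen (lift c) x y (fun u => (1 - c ^ 2) / (1 - 2 * c * cos u + c ^ 2)))
    as [z [Hz E]].
  - intros z _. now apply is_derive_lift.
  - intros z _. apply derivable_continuous_pt. eexists.
    apply is_derive_Reals. now apply is_derive_lift.
  - rewrite Rmin_left, Rmax_right in Hz by lra. now exists z.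
Qed.

Lemma lift_slope_le c p q : 0 < c < 1 -> cos p <= cos q ->
  (1 - c ^ 2) / (1 - 2 * c * cos p + c ^ 2) <= (1 - c ^ 2) / (1 - 2 * c * cos q + c ^ 2).
Proof.
  intros Hc Hle. pose proof (lift_denom_pos c p Hc). pose proof (lift_denom_pos c q Hc).
  apply Rmult_le_compat_l; [nra|]. apply Rinv_le_contravar; nra.
Qed.

Lemma lift_incr c x y : 0 < c < 1 -> x < y -> lift c x < lift c y.
Proof.
  intros Hc Hxy. destruct (lift_mvt c x y Hc Hxy) as [z [_ E]].
  pose proof (lift_denom_pos c z Hc).
  assert (0 < (1 - c ^ 2) / (1 - 2 * c * cos z + c ^ 2)) by (apply Rdiv_lt_0_compat; nra).
  nra.
Qed.

(** [lift c] maps [[-PI, 0]] into [[0, PI]], where the cosine is injective; the equation is that of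
    the cosines with denominators cleared. *)
Lemma lift_eq c u y : 0 < c < 1 -> - PI <= u <= 0 -> 0 <= y <= PI ->
  2 * c - (1 + c ^ 2) * cos u = cos y * (1 - 2 * c * cos u + c ^ 2) ->
  lift c u = y.
Proof.
  intros Hc Hu Hy E. pose proof (lift_denom_pos c u Hc).
  assert (H0 : lift c 0 = PI).
  { unfold lift. rewrite sin_0, Rmult_0_r, Rdiv_0_l, atan_0. ring. }
  assert (H1 : lift c (- PI) = 0).
  { unfold lift. rewrite sin_neg, sin_PI, Ropp_0, Rmult_0_r, Rdiv_0_l, atan_0. ring. }
  assert (0 <= lift c u <= PI).
  { split.
    - destruct (Req_dec u (- PI)) as [->|]; [lra|].
      rewrite <- H1. left. apply lift_incr; lra.
    - destruct (Req_dec u 0) as [->|]; [lra|].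
      rewrite <- H0. left. apply lift_incr; lra. }
  apply cos_inj; [easy..|]. rewrite cos_lift by easy. rewrite E. field. lra.
Qed.

Lemma cos_decr_abs x y : Rabs x <= y -> y <= PI -> cos y <= cos x.
Proof.
  intros Hx Hy. replace (cos x) with (cos (Rabs x)).
  - pose proof (Rabs_pos x). apply cos_decr_1; lra.
  - unfold Rabs. destruct (Rcase_abs x); [apply cos_neg|reflexivity].
Qed.

(** * Angles of the polygon and images of its boundary points *)

Definition theta (g : nat) : R := 2 * PI / NR g.

Lemma NR_ge g : (2 <= g)%nat -> 12 <= NR g.
Proof. intros hg. unfold NR, NZ. apply IZR_le. lia. Qed.

Lemma theta_bounds g : (2 <= g)%nat -> 0 < theta g <= PI / 6.
Proof.
  intros hg. pose proof (NR_ge g hg). pose proof PI_RGT_0. unfold theta. split.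
  - apply Rdiv_lt_0_compat; lra.
  - apply Rle_div_l; [lra|]. nra.
Qed.

Lemma theta_NR g : (2 <= g)%nat -> theta g * NR g = 2 * PI.
Proof. intros hg. pose proof (NR_ge g hg). unfold theta. field. lra. Qed.

Lemma cos_lower x : 0 <= x <= 1 -> 1 - x ^ 2 / 2 <= cos x.
Proof.
  intros Hx. replace x with (2 * (x / 2)) at 2 by field. rewrite cos_2a_sin.
  destruct (Req_dec x 0) as [->|Hx0].
  { rewrite Rdiv_0_l, sin_0. lra. }
  assert (sin (x / 2) < x / 2) by (apply sin_lt_x; lra).
  assert (0 < sin (x / 2)) by (apply sin_gt_0; pose proof PI2_1; lra).
  nra.
Qed.

Lemma sqrt2_bounds : 1.4 < sqrt 2 < 1.42.
Proof.
  split.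
  - rewrite <- (sqrt_pow2 1.4) by lra. apply sqrt_lt_1; lra.
  - rewrite <- (sqrt_pow2 1.42) by lra. apply sqrt_lt_1; lra.
Qed.

Lemma sin_alpha g : (2 <= g)%nat -> sin (alpha g) = sqrt 2 * sin (theta g / 2).
Proof.
  intros hg. pose proof (theta_bounds g hg). pose proof sqrt2_bounds. pose proof PI_4.
  unfold alpha. replace (PI / NR g) with (theta g / 2) by
    (unfold theta; field; pose proof (NR_ge g hg); lra).
  assert (sin (theta g / 2) < theta g / 2) by (apply sin_lt_x; lra).
  assert (0 < sin (theta g / 2)) by (apply sin_gt_0; lra).
  apply sin_asin. nra.
Qed.

(** The lower bound reflects [sqrt 2 > 1]. For small [theta] the ratio of [alpha] to [theta] is
    close to [sqrt 2 / 2], a little below [3 / 4]. *)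
Lemma alpha_bounds g : (2 <= g)%nat -> theta g / 2 < alpha g <= 3 / 4 * theta g.
Proof.
  intros hg. pose proof (theta_bounds g hg). pose proof sqrt2_bounds. pose proof PI_4.
  pose proof PI2_1. pose proof (sin_alpha g hg) as Hs.
  assert (- (PI / 2) <= alpha g <= PI / 2) by apply asin_bound.
  assert (Hs0 : 0 < sin (theta g / 2)) by (apply sin_gt_0; lra).
  split.
  - apply Rnot_le_lt. intros Hle.
    assert (sin (alpha g) <= sin (theta g / 2)) by (apply sin_incr_1; lra). nra.
  - apply Rnot_lt_le. intros Hlt.
    assert (Hss : sin (3 / 4 * theta g) < sin (alpha g)) by (apply sin_increasing_1; lra).
    (* With [y = theta / 4]: [sin 3y = sin y (4 cos^2 y - 1)], [sin 2y = 2 sin y cos y]. *)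
    set (y := theta g / 4) in *.
    assert (Hy : 0 < y <= 1 / 6) by (unfold y; lra).
    replace (3 / 4 * theta g) with (2 * y + y) in Hss by (unfold y; field).
    replace (theta g / 2) with (2 * y) in * by (unfold y; field).
    rewrite Hs, sin_plus, sin_2a, cos_2a_cos in Hss.
    pose proof (cos_lower y ltac:(lra)) as Hc. pose proof (COS_bound y).
    assert (Hsy : 0 < sin y) by (apply sin_gt_0; lra).
    assert (1 - 1 / 72 <= cos y) by nra.
    assert (Hsc : 0 < sin y * cos y) by (apply Rmult_lt_0_compat; lra).
    assert (0 <= (1.42 - sqrt 2) * (sin y * cos y)) by (apply Rmult_le_pos; lra).
    (* The number [2.84] is twice the bound [1.42] of [sqrt 2], the other 2 coming from [sin 2y];
       the quadratic is positive for [cos y >= 71 / 72]. *)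
    assert (0 <= sin y * (4 * cos y ^ 2 - 1 - 2.84 * cos y))
      by (apply Rmult_le_pos; nra).
    nra.
Qed.

Lemma cos_alpha_bounds g : (2 <= g)%nat -> 0 < cos (alpha g) < 1.
Proof.
  intros hg. pose proof (theta_bounds g hg). pose proof (alpha_bounds g hg).
  pose proof PI2_1. split; [apply cos_gt_0; lra|].
  rewrite <- cos_0. apply cos_decreasing_1; lra.
Qed.

(** This is the right angle at the vertices: the circles carrying two adjacent sides are orthogonal
    exactly under this relation. *)
Lemma cos_theta g : (2 <= g)%nat -> cos (theta g) = cos (alpha g) ^ 2.
Proof.
  intros hg. pose proof (sin_sq (alpha g)) as H. rewrite (sin_alpha g hg) in H.
  rewrite Rpow_mult_distr, pow2_sqrt in H by lra.
  replace (theta g) with (2 * (theta g / 2)) at 1 by field. rewrite cos_2a_sin. lra.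
Qed.

Lemma sin_theta_sq g : (2 <= g)%nat -> sin (theta g) ^ 2 = 1 - cos (alpha g) ^ 4.
Proof. intros hg. rewrite sin_sq, cos_theta by easy. ring. Qed.

(** Here [x] and [y] stand for the cosines of [theta + alpha] and [theta - alpha]. The two equations
    are the hypotheses of [lift_eq] for [P_(i-1)] and [Q_i]. *)
Lemma lift_vertex_identity c S x y : S ^ 2 = (1 - c ^ 4) * (1 - c ^ 2) ->
  x = c ^ 3 - S -> y = c ^ 3 + S ->
  2 * c - (1 + c ^ 2) * x = y * (1 - 2 * c * x + c ^ 2) /\
  2 * c - (1 + c ^ 2) * y = x * (1 - 2 * c * y + c ^ 2).
Proof.
  intros HS -> ->.
  replace (2 * c * (c ^ 3 - S)) with (2 * c ^ 4 - 2 * c * S) by ring.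
  replace (2 * c * (c ^ 3 + S)) with (2 * c ^ 4 + 2 * c * S) by ring.
  split.
  - transitivity (2 * c - c ^ 3 - c ^ 5 + S + c ^ 2 * S); [ring|].
    transitivity (c ^ 3 + S - 2 * c ^ 7 + c ^ 5 + S * c ^ 2 + 2 * c * S ^ 2); [|ring].
    rewrite HS. ring.
  - transitivity (2 * c - c ^ 3 - c ^ 5 - S - c ^ 2 * S); [ring|].
    transitivity (c ^ 3 - S - 2 * c ^ 7 + c ^ 5 - S * c ^ 2 + 2 * c * S ^ 2); [|ring].
    rewrite HS. ring.
Qed.

Lemma cos_alpha_theta g : (2 <= g)%nat -> let c := cos (alpha g) in
  let S := sin (theta g) * sin (alpha g) in
  S ^ 2 = (1 - c ^ 4) * (1 - c ^ 2) /\
  cos (theta g + alpha g) = c ^ 3 - S /\ cos (theta g - alpha g) = c ^ 3 + S.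
Proof.
  intros hg c S. unfold c, S. repeat split.
  - rewrite Rpow_mult_distr, sin_theta_sq, sin_sq by easy. ring.
  - rewrite cos_plus, cos_theta by easy. ring.
  - rewrite cos_minus, cos_theta by easy. ring.
Qed.

Lemma lift_prevP g : (2 <= g)%nat ->
  lift (cos (alpha g)) (- (theta g + alpha g)) = theta g - alpha g.
Proof.
  intros hg. pose proof (theta_bounds g hg). pose proof (alpha_bounds g hg).
  pose proof PI2_1. destruct (cos_alpha_theta g hg) as [HS [Hp Hm]].
  apply lift_eq; [now apply cos_alpha_bounds|lra|lra|]. rewrite cos_neg.
  apply (lift_vertex_identity _ _ _ _ HS Hp Hm).
Qed.

Lemma lift_Q g : (2 <= g)%nat ->
  lift (cos (alpha g)) (- (theta g - alpha g)) = theta g + alpha g.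
Proof.
  intros hg. pose proof (theta_bounds g hg). pose proof (alpha_bounds g hg).
  pose proof PI2_1. destruct (cos_alpha_theta g hg) as [HS [Hp Hm]].
  apply lift_eq; [now apply cos_alpha_bounds|lra|lra|]. rewrite cos_neg.
  apply (lift_vertex_identity _ _ _ _ HS Hp Hm).
Qed.

Lemma lift_P g : (2 <= g)%nat -> lift (cos (alpha g)) (- alpha g) = alpha g.
Proof.
  intros hg. pose proof (theta_bounds g hg). pose proof (alpha_bounds g hg).
  pose proof PI2_1.
  apply lift_eq; [now apply cos_alpha_bounds|lra|lra|]. rewrite cos_neg. ring.
Qed.

(* Angles are measured in units of [theta], so that sides are one unit apart
   and a full turn is [NZ g] units. *)
Definition scaled_lift (g : nat) (x : R) : R :=
  lift (cos (alpha g)) (theta g * x) / theta g.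

Definition scaled_alpha (g : nat) : R := alpha g / theta g.

Lemma scaled_lift_half_turn g : (2 <= g)%nat -> exists beta lambda,
  half_turn_lift (NZ g) (scaled_alpha g) (scaled_lift g) beta lambda.
Proof.
  intros hg. pose proof (theta_bounds g hg) as Ht. pose proof (alpha_bounds g hg) as Hal.
  pose proof (cos_alpha_bounds g hg) as Hc. pose proof PI2_1 as Hpi.
  pose proof (theta_NR g hg) as HtN. fold (NR g).
  set (t := theta g) in *. set (c := cos (alpha g)) in *.
  set (a := scaled_alpha g).
  assert (Eta : t * a = alpha g) by (unfold a, scaled_alpha; fold t; field; lra).
  assert (Ha : 1 / 2 < a <= 3 / 4) by (split; nra).
  assert (Eth : forall x, t * scaled_lift g x = lift c (t * x))
    by (intros x; unfold scaled_lift; fold t c; field; lra).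
  assert (Hreg : forall x y, t * x = t * y -> x = y)
    by (intros x y E; apply (Rmult_eq_reg_l t); lra).
  assert (HregL : forall x y, t * x < t * y -> x < y)
    by (intros x y E; apply (Rmult_lt_reg_l t); lra).
  assert (Hincr : forall x y, x < y -> scaled_lift g x < scaled_lift g y).
  { intros x y Hxy. apply HregL. rewrite !Eth. apply lift_incr; [easy|]. nra. }
  assert (Hlt_inv : forall x y, scaled_lift g x < scaled_lift g y -> x < y).
  { intros x y Hlt. apply Rnot_le_lt. intros [Hle| ->]; [apply Hincr in Hle|]; lra. }
  assert (Hshift : forall x, scaled_lift g (x + IZR (NZ g)) = scaled_lift g x + IZR (NZ g)).
  { intros x. fold (NR g). apply Hreg. rewrite Rmult_plus_distr_l, !Eth, HtN.
    rewrite Rmult_plus_distr_l, HtN. apply lift_shift. }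
  assert (Hinvol : forall x, scaled_lift g (scaled_lift g x) = x + IZR (NZ g)).
  { intros x. fold (NR g). apply Hreg.
    rewrite Rmult_plus_distr_l, !Eth, HtN. now apply lift_invol. }
  assert (HP : scaled_lift g (- a) = a).
  { apply Hreg. rewrite Eth, Ropp_mult_distr_r_reverse, Eta. now apply lift_P. }
  assert (HQ : scaled_lift g (a - 1) = 1 + a).
  { apply Hreg. rewrite Eth.
    replace (t * (a - 1)) with (- (t - alpha g)) by (rewrite <- Eta; ring).
    replace (t * (1 + a)) with (t + alpha g) by (rewrite <- Eta; ring).
    now apply lift_Q. }
  assert (Hmvt : forall p q, p < q -> exists z, p <= z <= q /\
    scaled_lift g q - scaled_lift g p =
    (1 - c ^ 2) / (1 - 2 * c * cos (t * z) + c ^ 2) * (q - p)).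
  { intros p q Hpq. destruct (lift_mvt c (t * p) (t * q) Hc ltac:(nra)) as [z [Hz E]].
    exists (z / t). replace (t * (z / t)) with z by (field; lra). split.
    - split; apply (Rmult_le_reg_l t); try lra;
        replace (t * (z / t)) with z by (field; lra); lra.
    - apply Hreg. rewrite Rmult_minus_distr_l, !Eth, E. ring. }
  (* The preimage of [2 - a], given explicitly by the involution. *)
  set (beta := scaled_lift g (2 - a) - IZR (NZ g)).
  assert (Hbeta : scaled_lift g beta = 2 - a).
  { pose proof (Hshift beta) as E. unfold beta in E at 1.
    replace (scaled_lift g (2 - a) - IZR (NZ g) + IZR (NZ g))
      with (scaled_lift g (2 - a)) in E by ring.
    rewrite Hinvol in E. lra. }
  assert (Hb : - a < beta < a - 1) by (split; apply Hlt_inv; lra).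
  assert (Habs : forall z b, - b <= z <= b -> b <= 1 -> cos (t * b) <= cos (t * z)).
  { intros z b Hz Hb1. apply cos_decr_abs; [apply Rabs_le|]; nra. }
  set (slope := fun z => (1 - c ^ 2) / (1 - 2 * c * cos (t * z) + c ^ 2)).
  assert (Hslope : forall z b, - b <= z <= b -> b <= 1 -> slope b <= slope z).
  { intros z b Hz Hb1. apply lift_slope_le; [easy|]. now apply Habs. }
  assert (Hslope_a : slope a = 1).
  { unfold slope. rewrite Eta. fold c. field. nra. }
  (* As [beta < a - 1], every [z] in [[beta, 1 - a]] satisfies [|z| <= - beta], so the slope is
     least at [beta]; it exceeds [slope a = 1] because [- beta < a]. *)
  exists beta, (slope beta). constructor; try easy.
  - now apply NR_ge.
  - apply Hreg. rewrite Eth.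
    replace (t * (- 1 - a)) with (- (t + alpha g)) by (rewrite <- Eta; ring).
    replace (t * (1 - a)) with (t - alpha g) by (rewrite <- Eta; ring).
    now apply lift_prevP.
  - (* The slope increases on [[- a, 0]], so [h] is convex there, and [- 1 / 2] is
       the midpoint of [- a] and [a - 1]. *)
    destruct (Hmvt (- a) (- (1 / 2)) ltac:(lra)) as [z1 [Hz1 E1]].
    destruct (Hmvt (- (1 / 2)) (a - 1) ltac:(lra)) as [z2 [Hz2 E2]].
    fold (slope z1) in E1. fold (slope z2) in E2.
    assert (slope z1 <= slope z2).
    { replace (slope z1) with (slope (- z1)); [apply Hslope; lra|].
      unfold slope. now rewrite Ropp_mult_distr_r_reverse, cos_neg. }
    nra.
  - intros x. fold (NR g). apply Hreg.
    rewrite Rmult_minus_distr_l, !Eth, HtN, Ropp_mult_distr_r_reverse. apply lift_odd.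
  - intros p q Hpq Hq. destruct (Req_dec p q) as [->|]; [lra|].
    destruct (Hmvt p q ltac:(lra)) as [z [Hz ->]]. fold (slope z).
    assert (1 <= slope z) by (rewrite <- Hslope_a; apply Hslope; lra). nra.
  - unfold slope.
    assert (Hlt : cos (t * a) < cos (t * beta)).
    { rewrite <- (cos_neg (t * beta)). apply cos_decreasing_1; nra. }
    rewrite Eta in Hlt. fold c in Hlt.
    pose proof (lift_denom_pos c (t * beta) Hc).
    apply Rlt_div_r; [lra|]. nra.
  - intros p q Hpq Hq. destruct (Req_dec p q) as [->|]; [lra|].
    destruct (Hmvt p q ltac:(lra)) as [z [Hz ->]]. fold (slope z).
    assert (slope beta <= slope z).
    { replace (slope beta) with (slope (- beta)); [apply Hslope; lra|].
      unfold slope. now rewrite Ropp_mult_distr_r_reverse, cos_neg. }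
    nra.
Qed.

(** * The Bowen-Series map on the circle *)

Lemma expi_plus x y : expi (x + y) = Cmult (expi x) (expi y).
Proof. unfold expi, Cmult; simpl. rewrite cos_plus, sin_plus. f_equal; ring. Qed.

Lemma expi_onS x : onS (expi x).
Proof.
  unfold onS, Cmod, expi; simpl. transitivity (sqrt 1); [|apply sqrt_1].
  f_equal. pose proof (sin2_cos2 x). unfold Rsqr in *. lra.
Qed.

Lemma onS_expi z : onS z -> exists t, z = expi t.
Proof.
  destruct z as [x y]. unfold onS, Cmod, expi; simpl. intros H.
  assert (H1 : x * x + y * y = 1).
  { rewrite <- (sqrt_sqrt (x * x + y * y)) by nra.
    replace (x * (x * 1) + y * (y * 1)) with (x * x + y * y) in H by ring.
    rewrite H. ring. }
  assert (Hx : -1 <= x <= 1) by nra.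
  assert (Hs : sqrt (1 - x²) = Rabs y).
  { replace (1 - x²) with (y²) by (unfold Rsqr; lra). apply sqrt_Rsqr_abs. }
  destruct (Rle_dec 0 y) as [Hy|Hy].
  - exists (acos x). rewrite cos_acos, sin_acos, Hs, Rabs_right by lra. easy.
  - exists (- acos x). rewrite cos_neg, sin_neg, cos_acos, sin_acos, Hs, Rabs_left by lra.
    f_equal. ring.
Qed.

Lemma expi_period x (k : Z) : expi (x + 2 * PI * IZR k) = expi x.
Proof.
  rewrite expi_plus.
  replace (expi (2 * PI * IZR k)) with (RtoC 1); [apply Cmult_1_r|].
  assert (Hs : sin (PI * IZR k) = 0) by (apply sin_eq_0_1; exists k; ring).
  replace (2 * PI * IZR k) with (2 * (PI * IZR k)) by ring.
  unfold expi, RtoC. rewrite cos_2a_sin, sin_2a, Hs. f_equal; ring.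
Qed.

Lemma expi_inj_period x y : expi x = expi y -> exists k : Z, x = y + 2 * PI * IZR k.
Proof.
  intros E. injection E as Ec Es.
  assert (Hcos : cos (x - y) = 1).
  { rewrite cos_minus, Ec, Es. pose proof (sin2_cos2 y). unfold Rsqr in *. lra. }
  replace (x - y) with (2 * ((x - y) / 2)) in Hcos by field.
  rewrite cos_2a_sin in Hcos.
  destruct (sin_eq_0_0 ((x - y) / 2)) as [k Hk]; [nra|].
  exists k. lra.
Qed.

Lemma half_turn_expi c x : 0 < c < 1 ->
  Cdiv (Cminus (RtoC c) (expi x)) (Cminus (RtoC 1) (Cmult (RtoC c) (expi x))) =
  expi (lift c x).
Proof.
  intros Hc. pose proof (one_minus_cos_pos c x Hc). pose proof (lift_denom_pos c x Hc).
  pose proof (sin_sq x) as Hs.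
  set (b := Cminus (RtoC 1) (Cmult (RtoC c) (expi x))).
  assert (Hb : b <> RtoC 0).
  { intros E. apply (f_equal fst) in E. revert E. unfold b, expi; simpl. lra. }
  replace (Cminus (RtoC c) (expi x)) with (Cmult (expi (lift c x)) b).
  { unfold Cdiv. rewrite <- Cmult_assoc, Cinv_r, Cmult_1_r; easy. }
  unfold b, expi, Cminus, Cmult, RtoC, Cplus, Copp; simpl.
  rewrite cos_lift, sin_lift by easy. f_equal.
  - apply (Rmult_eq_reg_r (1 - 2 * c * cos x + c ^ 2)); [|lra].
    transitivity ((2 * c - (1 + c ^ 2) * cos x) * (1 - c * cos x)
      - (1 - c ^ 2) * c * sin x ^ 2); [field; lra|].
    rewrite Hs. ring.
  - field. lra.
Qed.

Definition circ (g : nat) (x : R) : C := expi (theta g * x).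

Lemma circ_period g x (k : Z) : (2 <= g)%nat -> circ g (x + IZR (k * NZ g)) = circ g x.
Proof.
  intros hg. unfold circ. rewrite mult_IZR. fold (NR g).
  replace (theta g * (x + IZR k * NR g)) with (theta g * x + (theta g * NR g) * IZR k) by ring.
  rewrite theta_NR by easy. apply expi_period.
Qed.

Lemma circ_inj g x y : (2 <= g)%nat -> circ g x = circ g y ->
  exists k : Z, x = y + IZR k * IZR (NZ g).
Proof.
  intros hg E. apply expi_inj_period in E. destruct E as [k E]. exists k.
  fold (NR g). pose proof (theta_bounds g hg).
  apply (Rmult_eq_reg_l (theta g)); [|lra].
  rewrite E, <- (theta_NR g hg). ring.
Qed.

Lemma expi_circ g x : (2 <= g)%nat -> expi x = circ g (x / theta g).
Proof.
  intros hg. pose proof (theta_bounds g hg). unfold circ. f_equal. field. lra.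
Qed.

Lemma circ_window g (i j : Z) u v b : (2 <= g)%nat -> b <= u < b + 1 -> b <= v < b + 1 ->
  circ g (IZR i + u) = circ g (IZR j + v) ->
  u = v /\ exists k : Z, i = (j + k * NZ g)%Z.
Proof.
  intros hg Hu Hv E. apply circ_inj in E; [|easy]. destruct E as [k E].
  rewrite <- mult_IZR in E.
  assert (Hd : (i - j - k * NZ g = 0)%Z).
  { apply one_IZR_lt1. rewrite !minus_IZR. lra. }
  assert (i = (j + k * NZ g)%Z) as -> by lia.
  rewrite plus_IZR in E. split; [lra|]. now exists k.
Qed.

Lemma sigma_invol (g : nat) (i : Z) : Defs.sigma g (Defs.sigma g i) = i.
Proof.
  unfold Defs.sigma. destruct (Z.odd i) eqn:Ho.
  - replace (Z.odd (4 * Z.of_nat g - i)) with true; [ring|].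
    rewrite Z.odd_sub, Ho, Z.odd_mul. reflexivity.
  - replace (Z.odd (2 - i)) with false; [ring|].
    rewrite Z.odd_sub, Ho. reflexivity.
Qed.

(** [NZ g] is even, so the shift keeps the parity that selects the branch; both branches reverse
    orientation, hence the sign. *)
Lemma sigma_period (g : nat) (i k : Z) : Defs.sigma g (i + k * NZ g) = (Defs.sigma g i - k * NZ g)%Z.
Proof.
  unfold Defs.sigma. replace (Z.odd (i + k * NZ g)) with (Z.odd i).
  - destruct (Z.odd i); ring.
  - unfold NZ. rewrite Z.odd_add, Z.odd_mul, Z.odd_sub, Z.odd_mul.
    rewrite Bool.andb_false_r. now destruct (Z.odd i).
Qed.

Lemma T_circ g (i : Z) u : (2 <= g)%nat ->
  T g i (circ g (IZR i + u)) = circ g (IZR (Defs.sigma g i) + scaled_lift g u).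
Proof.
  intros hg. pose proof (theta_bounds g hg).
  assert (Hphi : forall j, phi g j = theta g * IZR j)
    by (intros j; unfold phi, theta, Rdiv; ring).
  unfold T, circ. cbv zeta. rewrite !Hphi, <- expi_plus.
  replace (- (theta g * IZR i) + theta g * (IZR i + u)) with (theta g * u) by ring.
  rewrite half_turn_expi, <- expi_plus by now apply cos_alpha_bounds.
  f_equal. unfold scaled_lift. field. lra.
Qed.

Lemma in_arc_circ g (i : Z) z : (2 <= g)%nat -> in_arc (angP g i) (angP g (i + 1)) z <->
  exists u, - scaled_alpha g <= u < 1 - scaled_alpha g /\ z = circ g (IZR i + u).
Proof.
  intros hg. pose proof (theta_bounds g hg).
  assert (Hang : forall j, angP g j = theta g * (IZR j - scaled_alpha g)).
  { intros j. pose proof (NR_ge g hg). unfold angP, phi, scaled_alpha.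
    replace (2 * PI * IZR j / NR g) with (theta g * IZR j) by (unfold theta, Rdiv; ring).
    field. lra. }
  unfold in_arc. rewrite !Hang, plus_IZR. split.
  - intros [t [Ht ->]]. exists (t / theta g - IZR i).
    replace (IZR i + (t / theta g - IZR i)) with (t / theta g) by ring.
    split; [|now apply expi_circ].
    assert (Et : theta g * (t / theta g) = t) by (field; lra).
    split; [apply (Rmult_le_reg_l (theta g))|apply (Rmult_lt_reg_l (theta g))];
      rewrite ?Rmult_minus_distr_l, ?Et; lra.
  - intros [u [Hu ->]]. exists (theta g * (IZR i + u)). split; [|easy].
    split; nra.
Qed.

(** The half-open arcs tile the circle, so whichever index [epsilon] picks is [i] up to full turns,
    and [circ] does not see full turns. *)
Lemma idx_circ g (i : Z) u : (2 <= g)%nat ->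
  - scaled_alpha g <= u < 1 - scaled_alpha g ->
  exists k : Z, idx g (circ g (IZR i + u)) = (i + k * NZ g)%Z.
Proof.
  intros hg Hu.
  assert (HN : (0 < NZ g)%Z) by (unfold NZ; lia).
  assert (Hex : exists j : Z, (1 <= j <= NZ g)%Z /\
     in_arc (angP g j) (angP g (j + 1)) (circ g (IZR i + u))).
  { exists (1 + (i - 1) mod NZ g)%Z. split.
    - pose proof (Z.mod_pos_bound (i - 1) (NZ g) HN). lia.
    - apply in_arc_circ; [easy|]. exists u. split; [easy|].
      rewrite <- (circ_period g (IZR (1 + (i - 1) mod NZ g) + u) ((i - 1) / NZ g) hg).
      replace (IZR i) with (IZR (1 + (i - 1) mod NZ g + (i - 1) / NZ g * NZ g)).
      + rewrite !plus_IZR. f_equal. ring.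
      + f_equal. pose proof (Z.div_mod (i - 1) (NZ g)). lia. }
  unfold idx.
  destruct (ClassicalEpsilon.epsilon_spec (inhabits 1%Z) _ Hex) as [_ Harc].
  apply in_arc_circ in Harc; [|easy]. destruct Harc as [u' [Hu' E]].
  symmetry in E. apply (circ_window _ _ _ _ _ (- scaled_alpha g)) in E; try easy; try lra.
Qed.

Lemma F_circ g (i : Z) u v : (2 <= g)%nat ->
  - scaled_alpha g <= u < 1 - scaled_alpha g ->
  F g (circ g (IZR i + v), circ g (IZR i + u)) =
  (circ g (IZR (Defs.sigma g i) + scaled_lift g v), circ g (IZR (Defs.sigma g i) + scaled_lift g u)).
Proof.
  intros hg Hu. unfold F. simpl.
  destruct (idx_circ g i u hg Hu) as [k ->].
  assert (Hc : forall w, circ g (IZR i + w) = circ g (IZR (i + k * NZ g) + w)).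
  { intros w. rewrite plus_IZR, <- (circ_period g (IZR i + w) k hg). f_equal. ring. }
  assert (Hs : forall w, circ g (IZR (Defs.sigma g (i + k * NZ g)) + w) = circ g (IZR (Defs.sigma g i) + w)).
  { intros w. rewrite sigma_period, minus_IZR.
    rewrite <- (circ_period g _ k hg). f_equal. ring. }
  now rewrite !Hc, !T_circ, !Hs.
Qed.

(** * The attractor on the circle *)

(** The point [x], at [v], comes first in the pair, and [y], at [u], second. As [i] runs over all
    integers, descriptions repeat after a full turn; by [circ_pair_inj] this is the only
    ambiguity. *)
Definition Om_P (g : nat) (p : C * C) : Prop := exists (i : Z) u v,
  rel_Om (NZ g) (scaled_alpha g) u v /\ p = (circ g (IZR i + v), circ g (IZR i + u)).

Lemma rel_Om_bounds N a u v : 1 / 2 < a <= 3 / 4 -> rel_Om N a u v ->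
  - a <= u < 1 - a /\ u < v < u + IZR N.
Proof. intros Ha [H|H]; lra. Qed.

Lemma circ_pair_inj g (i j : Z) u v u' v' : (2 <= g)%nat ->
  - scaled_alpha g <= u < 1 - scaled_alpha g -> u < v < u + IZR (NZ g) ->
  - scaled_alpha g <= u' < 1 - scaled_alpha g -> u' < v' < u' + IZR (NZ g) ->
  circ g (IZR i + u) = circ g (IZR j + u') -> circ g (IZR i + v) = circ g (IZR j + v') ->
  u = u' /\ v = v' /\ exists k : Z, i = (j + k * NZ g)%Z.
Proof.
  intros hg Hu Hv Hu' Hv' Eu Ev.
  destruct (circ_window g i j u u' (- scaled_alpha g) hg ltac:(lra) ltac:(lra) Eu)
    as [<- [k ->]].
  split; [easy|]. split; [|now exists k].
  destruct (circ_inj g _ _ hg Ev) as [l El]. rewrite plus_IZR, mult_IZR in El.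
  pose proof (NR_ge g hg) as HN. unfold NR in HN.
  assert (Hl : (l - k = 0)%Z).
  { apply one_IZR_lt1. rewrite minus_IZR.
    split; apply (Rmult_lt_reg_r (IZR (NZ g))); lra. }
  assert (l = k) as -> by lia. lra.
Qed.

Lemma inD_circ g p : (2 <= g)%nat -> inD p -> exists (i : Z) u v,
  - scaled_alpha g <= u < 1 - scaled_alpha g /\ u < v < u + IZR (NZ g) /\
  p = (circ g (IZR i + v), circ g (IZR i + u)).
Proof.
  intros hg. destruct p as [x y]. intros [Hx [Hy Hxy]]. simpl in *.
  destruct (onS_expi x Hx) as [tx ->]. destruct (onS_expi y Hy) as [ty ->].
  rewrite (expi_circ g tx), (expi_circ g ty) in * by easy.
  generalize dependent (tx / theta g). generalize dependent (ty / theta g).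
  clear tx ty. intros Y HY X HX Hne.
  pose proof (NR_ge g hg) as HN. unfold NR in HN.
  destruct (unit_window (- scaled_alpha g) Y) as [i Hi].
  destruct (unit_window 0 ((X - Y) / IZR (NZ g))) as [m Hm].
  assert (E : X - Y = IZR (NZ g) * ((X - Y) / IZR (NZ g))) by (field; lra).
  exists i, (Y - IZR i), (X - IZR (m * NZ g) - IZR i).
  replace (IZR i + (Y - IZR i)) with Y by ring.
  replace (IZR i + (X - IZR (m * NZ g) - IZR i)) with (X - IZR (m * NZ g)) by ring.
  assert (EX : circ g (X - IZR (m * NZ g)) = circ g X).
  { rewrite <- (circ_period g _ m hg). f_equal. ring. }
  rewrite EX. split; [lra|]. split; [|easy].
  (* Since [x] and [y] differ, the lift of [x] is not at the closed left end of its window. *)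
  assert (HXY : X - IZR (m * NZ g) <> Y) by congruence.
  rewrite mult_IZR in *. nra.
Qed.

Lemma Om_P_bij_domain g : (2 <= g)%nat -> bij_domain g (Om_P g).
Proof.
  intros hg. destruct (scaled_lift_half_turn g hg) as [beta [lambda H]].
  pose proof (htl_a _ _ _ _ _ H) as Ha.
  assert (Hmove : forall (j m : Z) w, IZR j + w = IZR (j + m) + (w - IZR m))
    by (intros; rewrite plus_IZR; ring).
  split; [|split; [|split]].
  - intros p [i [u [v [HO ->]]]]. destruct (rel_Om_bounds _ _ _ _ Ha HO) as [Hu Hv].
    split; [apply expi_onS|]. split; [apply expi_onS|]. simpl. intros E.
    destruct (circ_inj g _ _ hg E) as [k Ek].
    pose proof (NR_ge g hg) as HN. unfold NR in HN.
    assert (0 < IZR k < 1) as [Hk1 Hk2]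
      by (split; apply (Rmult_lt_reg_r (IZR (NZ g))); lra).
    apply lt_IZR in Hk1, Hk2. lia.
  - intros p [i [u [v [HO ->]]]]. destruct (rel_Om_bounds _ _ _ _ Ha HO) as [Hu Hv].
    rewrite F_circ by easy.
    destruct (next_index _ _ _ _ _ H u Hu) as [m [Hm _]].
    exists (Defs.sigma g i + m)%Z, (scaled_lift g u - IZR m), (scaled_lift g v - IZR m).
    split; [now apply (rel_Om_step _ _ _ _ _ H)|]. now rewrite <- !Hmove.
  - intros p q [i [u [v [HO ->]]]] [i' [u' [v' [HO' ->]]]] E.
    destruct (rel_Om_bounds _ _ _ _ Ha HO) as [Hu Hv].
    destruct (rel_Om_bounds _ _ _ _ Ha HO') as [Hu' Hv'].
    rewrite !F_circ in E by easy.
    destruct (next_index _ _ _ _ _ H u Hu) as [m [Hm _]].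
    destruct (next_index _ _ _ _ _ H u' Hu') as [m' [Hm' _]].
    rewrite (Hmove (Defs.sigma g i) m), (Hmove (Defs.sigma g i) m), (Hmove (Defs.sigma g i') m'),
      (Hmove (Defs.sigma g i') m') in E.
    apply pair_equal_spec in E. destruct E as [Ev Eu].
    destruct (rel_Om_bounds _ _ _ _ Ha (rel_Om_step _ _ _ _ _ H u v m HO Hm)) as [_ HB].
    destruct (rel_Om_bounds _ _ _ _ Ha (rel_Om_step _ _ _ _ _ H u' v' m' HO' Hm')) as [_ HB'].
    destruct (circ_pair_inj g _ _ _ _ _ _ hg Hm HB Hm' HB' Eu Ev) as [E1 [E2 [k Ek]]].
    destruct (rel_Om_step_inj _ _ _ _ _ H u v u' v' m m' HO HO' Hm E1 E2)
      as [-> [-> ->]].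
    (* Since [m = m'], the sides [sigma i] and [sigma i'] agree up to full turns, and then so do [i]
       and [i'], [sigma] being an involution. *)
    assert (Hs : Defs.sigma g i = (Defs.sigma g i' + k * NZ g)%Z) by lia.
    apply (f_equal (Defs.sigma g)) in Hs. rewrite sigma_period, !sigma_invol in Hs.
    assert (Hc : forall w, circ g (IZR i + w) = circ g (IZR i' + w)).
    { intros w. rewrite Hs, minus_IZR, <- (circ_period g _ k hg). f_equal. ring. }
    now rewrite !Hc.
  - intros q [j [u [v [HO ->]]]].
    destruct (rel_Om_step_surj _ _ _ _ _ H u v HO) as [u0 [v0 [m [HO0 [Eu Ev]]]]].
    destruct (rel_Om_bounds _ _ _ _ Ha HO0) as [Hu0 _].
    (* A step leads from side [i] to side [sigma i + m], so the preimage of a point at side [j] sits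
       at side [sigma (j - m)]. *)
    exists (circ g (IZR (Defs.sigma g (j - m)) + v0), circ g (IZR (Defs.sigma g (j - m)) + u0)).
    split; [now exists (Defs.sigma g (j - m)), u0, v0|].
    rewrite F_circ, sigma_invol, !(Hmove (j - m)%Z m), Eu, Ev by easy.
    now replace (j - m + m)%Z with j by ring.
Qed.

Lemma reaches_Om_P g : (2 <= g)%nat -> forall u v,
  reaches (NZ g) (scaled_alpha g) (scaled_lift g) u v ->
  - scaled_alpha g <= u < 1 - scaled_alpha g -> forall i : Z, exists n : nat,
  Om_P g (Nat.iter n (F g) (circ g (IZR i + v), circ g (IZR i + u))).
Proof.
  intros hg u v Hr. induction Hr as [u v HO|u v m Hm _ IH]; intros Hu i.
  - exists 0%nat. now exists i, u, v.
  - destruct (IH Hm (Defs.sigma g i + m)%Z) as [n Hn]. exists (S n).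
    rewrite Nat.iter_succ_r, F_circ by easy. rewrite plus_IZR in Hn.
    replace (IZR (Defs.sigma g i) + scaled_lift g v) with
      (IZR (Defs.sigma g i) + IZR m + (scaled_lift g v - IZR m)) by ring.
    replace (IZR (Defs.sigma g i) + scaled_lift g u) with
      (IZR (Defs.sigma g i) + IZR m + (scaled_lift g u - IZR m)) by ring.
    exact Hn.
Qed.

Definition side_index (g : nat) (y : R) : Z := Int_part (y / theta g + scaled_alpha g).

Lemma Om_P_finite_rect g : (2 <= g)%nat -> finite_rect (Om_P g).
Proof.
  intros hg. pose proof (theta_bounds g hg) as Ht. pose proof (NR_ge g hg) as HN.
  pose proof (theta_NR g hg) as HtN.
  destruct (scaled_lift_half_turn g hg) as [beta [lambda H]].
  pose proof (htl_a _ _ _ _ _ H) as Ha. clear beta lambda H.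
  set (t := theta g) in *. set (a := scaled_alpha g) in *.
  assert (Hdiv : forall y, t * (y / t) = y) by (intros y; field; lra).
  assert (Hix : forall y,
    - a <= y / t - IZR (side_index g y) < 1 - a).
  { intros y. unfold side_index. fold t a.
    destruct (base_Int_part (y / t + a)). lra. }
  set (top := fun i d => t * (IZR i + NR g - d)).
  set (depth := fun y => if Rlt_dec (y / t - IZR (side_index g y)) (a - 1)
                         then 1 + a else a).
  set (sides := map Z.of_nat (seq 0 (Z.to_nat (NZ g)))).
  (* Starting at [P_0 = - alpha] makes the side indices over one turn run exactly through
     [0, ..., N - 1]. *)
  exists (- alpha g), (fun y => t * (IZR (side_index g y) + 1 + a)),
    (fun y => top (side_index g y) (depth y)),
    (map (fun i => t * (IZR i + 1 + a)) sides),
    (map (fun i => top i (1 + a)) sides ++ map (fun i => top i a) sides).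
  assert (Eta : t * a = alpha g) by (unfold a, scaled_alpha; fold t; field; lra).
  split; [|split].
  - intros y Hy.
    assert (Hi : In (side_index g y) sides).
    { apply in_map_iff. exists (Z.to_nat (side_index g y)).
      assert (Hr : - a <= y / t < NR g - a).
      { pose proof (Hdiv y). split; [apply (Rmult_le_reg_l t)|apply (Rmult_lt_reg_l t)]; lra. }
      pose proof (Hix y).
      assert (0 <= side_index g y)%Z by (apply le_IZR, IZR_gt_ge; lra).
      assert (side_index g y < NZ g)%Z by (apply lt_IZR; fold (NR g); lra).
      rewrite in_seq. lia. }
    split; [now apply (in_map (fun i => t * (IZR i + 1 + a)))|].
    apply in_or_app. unfold depth.
    destruct (Rlt_dec _ _); [left|right].
    + now apply (in_map (fun i => top i (1 + a))).
    + now apply (in_map (fun i => top i a)).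
  - intros y1 y2 Hy _.
    assert (Hyt : y1 / t <= y2 / t) by (apply Rmult_le_compat_r; [left; apply Rinv_0_lt_compat|]; lra).
    pose proof (Hix y1). pose proof (Hix y2).
    assert (Hle : IZR (side_index g y1) <= IZR (side_index g y2)) by (apply IZR_gt_ge; lra).
    split; [apply Rmult_le_compat_l; lra|].
    unfold top. apply Rmult_le_compat_l; [lra|]. unfold depth.
    (* At a point P the depth jumps from [a] back to [1 + a], which the increase of the side index
       by at least one compensates. *)
    destruct (Rle_lt_or_eq_dec _ _ Hle) as [Hlt|Heq].
    + assert (IZR (side_index g y1) <= IZR (side_index g y2) - 1)
        by (apply IZR_lt_le_minus; lra).
      destruct (Rlt_dec _ _), (Rlt_dec _ _); lra.
    + destruct (Rlt_dec _ _), (Rlt_dec _ _); lra.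
  - intros x y Hy Hxy. pose proof (Hix y) as Hu.
    set (i := side_index g y) in *. set (u := y / t - IZR i) in *.
    set (v := x / t - IZR i).
    assert (Hv : u < v < u + IZR (NZ g)).
    { fold (NR g). pose proof (Hdiv x). pose proof (Hdiv y). unfold u, v.
      split; apply (Rmult_lt_reg_l t); lra. }
    assert (Ex : x = t * (IZR i + v)) by (unfold v; pose proof (Hdiv x); lra).
    assert (Eex : expi x = circ g (IZR i + v)) by (unfold circ; now rewrite Ex).
    assert (Eey : expi y = circ g (IZR i + u))
      by (unfold circ, u; fold t; f_equal; pose proof (Hdiv y); lra).
    rewrite Eex, Eey. unfold top, depth. fold i u.
    split.
    + intros [Hx1 Hx2]. rewrite Ex in Hx1, Hx2.
      apply Rmult_lt_reg_l in Hx1; [|lra]. apply Rmult_lt_reg_l in Hx2; [|lra].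
      exists i, u, v. split; [|easy]. unfold NR in *. fold a.
      destruct (Rlt_dec u (a - 1)); [left|right]; lra.
    + intros [j [u' [v' [HO E]]]]. apply pair_equal_spec in E. destruct E as [Ev Eu].
      destruct (rel_Om_bounds _ _ _ _ Ha HO) as [Hu' Hv'].
      destruct (circ_pair_inj g _ _ _ _ _ _ hg Hu Hv Hu' Hv' Eu Ev) as [<- [<- _]].
      fold a in HO. unfold NR. rewrite Ex.
      split; apply Rmult_le_compat_l; try lra.
      * destruct HO; lra.
      * destruct HO, (Rlt_dec u (a - 1)); lra.
Qed.

Theorem theorem2p1 (g : nat) (hg : (2 <= g)%nat) :
  exists Om : C * C -> Prop,
    bij_domain g Om /\ finite_rect Om /\
    (forall p, inD p -> exists n : nat, Om (Nat.iter n (F g) p)).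
Proof.
  exists (Om_P g). split; [now apply Om_P_bij_domain|].
  split; [now apply Om_P_finite_rect|].
  intros p Hp. destruct (inD_circ g p hg Hp) as [i [u [v [Hu [Hv ->]]]]].
  destruct (scaled_lift_half_turn g hg) as [beta [lambda H]].
  apply reaches_Om_P; [easy| |easy]. now apply (reaches_all _ _ _ _ _ H).
Qed.
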